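(* Let $X_1$, $X_2$ and $Y$ be infinite-dimensional Banach spaces and let $1\le p_1,p_2<+\infty$. Then there exists a continuous bilinear mapping $A\colon X_1\times X_2\to Y$ which fails to be $(p_1,p_2)$-dominated.
   Context: Banach spaces are over $\mathbb{K}=\mathbb{R}$ or $\mathbb{C}$ (the same field for all spaces). $X'$ is the topological dual of $X$. For $0<q<+\infty$, $\ell_q(Y)$ is the space of sequences $(y_j)_{j=1}^\infty$ in $Y$ with $\sum_j\|y_j\|^q<\infty$. For $1\le p<+\infty$, $\ell_p^w(X)$ is the space of sequences $(x_j)_{j=1}^\infty$ in $X$ such that $(\varphi(x_j))_{j=1}^\infty\in\ell_p$ for every $\varphi\in X'$. A continuous bilinear mapping $A\colon X_1\times X_2\to Y$ is $(p_1,p_2)$-dominated, $1\le p_1,p_2<+\infty$, if $(A(x_j^1,x_j^2))_{j=1}^\infty\in\ell_q(Y)$ whenever $(x_j^k)_{j=1}^\infty\in\ell_{p_k}^w(X_k)$, $k=1,2$, where $\frac1q=\frac1{p_1}+\frac1{p_2}$. *)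

(* Defs.v *)
From mathcomp Require Import all_boot all_order all_algebra.
From mathcomp Require Import all_classical all_reals all_analysis.
From mathcomp Require Import complex.

Set Implicit Arguments.
Unset Strict Implicit.
Unset Printing Implicit Defensive.

Import Order.TTheory GRing.Theory Num.Theory.
Import numFieldNormedType.Exports.

Local Open Scope classical_set_scope.
Local Open Scope ring_scope.

Inductive scalar_kind : Set := RealScalars | ComplexScalars.

Definition scalar_field (R : realType) (k : scalar_kind) : numFieldType :=
  match k with
  | RealScalars => R
  | ComplexScalars => R[i]
  end.

Definition scalar_Re (R : realType) (k : scalar_kind) :
    scalar_field R k -> R :=
  match k return scalar_field R k -> R with
  | RealScalars => fun z => z
  | ComplexScalars => fun z => complex.Re z
  end.

(* The library norm of a normedModType over K takes its values in K itself
   (in the nonnegative reals of K), so over the complex numbers it has to be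
   brought back to R before real powers can be taken. *)
Definition rnorm (R : realType) (k : scalar_kind)
    (X : normedModType (scalar_field R k)) (x : X) : R :=
  scalar_Re `|x|.

Definition finite_dimensional (K : fieldType) (V : lmodType K) : Prop :=
  exists (n : nat) (e : 'I_n -> V),
    forall v : V, exists c : 'I_n -> K, v = \sum_(i < n) c i *: e i.

Definition infinite_dimensional (K : fieldType) (V : lmodType K) : Prop :=
  ~ finite_dimensional V.

Definition in_lp (R : realType) (k : scalar_kind)
    (X : normedModType (scalar_field R k)) (q : R) (x : nat -> X) : Prop :=
  (\sum_(0 <= j <oo) (rnorm (x j) `^ q)%:E < +oo)%E.

Definition in_weak_lp (R : realType) (k : scalar_kind)
    (X : normedModType (scalar_field R k)) (p : R) (x : nat -> X) : Prop :=
  forall phi : {linear X -> (scalar_field R k)^o},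
    continuous phi -> in_lp p (fun j => phi (x j)).

Definition dominated (R : realType) (k : scalar_kind)
    (X1 X2 Y : normedModType (scalar_field R k)) (p1 p2 : R)
    (A : X1 -> X2 -> Y) : Prop :=
  forall (x1 : nat -> X1) (x2 : nat -> X2),
    in_weak_lp p1 x1 -> in_weak_lp p2 x2 ->
    in_lp (p1^-1 + p2^-1)^-1 (fun j => A (x1 j) (x2 j)).

(* Main.v *)
Require Import Defs.
From HB Require Import structures.
From mathcomp Require Import all_boot all_order all_algebra.
From mathcomp Require Import all_classical all_reals all_analysis.
From mathcomp Require Import perm complex ring lra.

(** A bilinear map that is not dominated is obtained as the sum of a rapidly
    decreasing series of bilinear maps of finite rank, each of which spoils the
    estimates on its own finite block of vectors.

    The source of the blocks is the Dvoretzky--Rogers lemma: an infinite-dimensional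
    normed space contains, for every [N], vectors [x_1, ..., x_N] of norm at least
    [2/5] that are dominated by an orthonormal system, up to a factor [2]
    ([Dvoretzky_Rogers_space]).  The same holds in the dual ([Dvoretzky_Rogers_dual]).
    It is applied to get such [x_i] in [X1], functionals [psi_i] on [X2] and [y_i] in
    [Y]; let [phi_i] be a norming functional of [x_i].  For all signs [eps_i] the map
    [D(a, b) = sum_i eps_i phi_i(a) psi_i(b) y_i] has norm at most [4], since the
    [phi_i] are bounded by [1] while the [psi_i(b)] are square-summable and the [y_i]
    satisfy an upper Euclidean estimate.  On the other hand, with [z_i] in the unit
    ball such that [psi_i(z_i)] is not small, flipping the [i]-th sign shows that for
    some choice of signs [(P + D)(x_i, z_i)] is bounded below for at least half of
    the [i], whatever map [P] was there before ([exists_good_signs],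
    [small_perturbation]).

    Now the [x_i] are weakly summable to any power [p1 >= 1] with a sum of order at
    most [sqrt N], instead of [N].  Scaling the [x_i] by [alpha] with
    [alpha^p1 sqrt N] small, and the [z_i] by [lambda] with [lambda^p2 N] small,
    leaves the sum of the [q]-th powers of the values larger than a multiple of
    [N^(q / (2 p1))], hence at least [1/2] for large [N], no matter how small [D] was
    made ([exists_weights], [exists_block]).  Adding perturbations whose norms
    decrease geometrically, with a ratio so small that the later ones do not destroy
    the lower bounds of the earlier ones, gives the required map: the concatenation
    of the blocks is weakly summable on both sides, but the values on it are not
    [q]-summable.

    The Dvoretzky--Rogers lemma is proved by almost maximizing a determinant over the
    contractions from a Euclidean space ([Dvoretzky_Rogers]).  Working in coordinates
    requires biorthogonal systems ([biorthogonal]), which come from the Hahn--Banach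
    theorem.  The latter is proved in the form that minimal sublinear functionals are
    linear ([Hahn_Banach], [norming_functional]).  All estimates are made with real
    coefficients where possible; passing to complex coefficients costs a factor [2]
    ([real_to_scalar_bound]). *)

Set Implicit Arguments.
Unset Strict Implicit.
Unset Printing Implicit Defensive.

Import Order.TTheory GRing.Theory Num.Theory.
Import numFieldNormedType.Exports.
Local Open Scope classical_set_scope.
Local Open Scope ring_scope.

(** * The Dvoretzky--Rogers lemma in coordinates *)

Section Euclid.
Variable R : realType.

(** The Euclidean norm of a row vector *)
Definition enorm n (a : 'rV[R]_n) : R := Num.sqrt ((a *m a^T) 0 0).

Lemma dot_self n (a : 'rV[R]_n) : (a *m a^T) 0 0 = \sum_i a 0 i ^+ 2.
Proof. by rewrite mxE; apply: eq_bigr => i _; rewrite mxE expr2. Qed.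

Lemma dot_self_ge0 n (a : 'rV[R]_n) : 0 <= (a *m a^T) 0 0.
Proof. by rewrite dot_self sumr_ge0// => i _; rewrite sqr_ge0. Qed.

Lemma enorm_ge0 n (a : 'rV[R]_n) : 0 <= enorm a.
Proof. exact: sqrtr_ge0. Qed.

Lemma enorm_eq0 n (a : 'rV[R]_n) : enorm a = 0 -> a = 0.
Proof.
move=> /eqP; rewrite sqrtr_eq0 dot_self => h.
apply/rowP => i; rewrite mxE; apply/eqP.
have h0 : \sum_i a 0 i ^+ 2 == 0.
  by rewrite eq_le h sumr_ge0// => j _; rewrite sqr_ge0.
move: h0; rewrite psumr_eq0; last by move=> j _; rewrite sqr_ge0.
by move=> /allP/(_ i (mem_index_enum i)); rewrite /= sqrf_eq0.
Qed.

Lemma enormZ n t (a : 'rV[R]_n) : enorm (t *: a) = `|t| * enorm a.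
Proof.
rewrite /enorm linearZ/= -scalemxAl -scalemxAr scalerA mxE -expr2 sqrtrM ?sqr_ge0//.
by rewrite sqrtr_sqr.
Qed.

Lemma enorm_delta n (i : 'I_n) : enorm (delta_mx 0 i) = 1.
Proof.
rewrite /enorm dot_self (bigD1 i)//= mxE !eqxx expr1n big1 ?addr0 ?sqrtr1//.
by move=> j ji; rewrite mxE (negPf ji) andbF expr0n.
Qed.

(** If the [k] rows of [Q] are orthonormal, then [2 - Q^T Q] has the eigenvalue
    [1] with multiplicity [k] and the eigenvalue [2] on the orthogonal
    complement; the proof is Sylvester's determinant identity. *)
Lemma det_two_sub_proj k n (Q : 'M[R]_(k, n)) : Q *m Q^T = 1%:M ->
  \det (2%:M - Q^T *m Q) * 2 ^+ k = 2 ^+ n.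
Proof.
move=> QQ.
pose B := block_mx (1%:M : 'M[R]_k) Q Q^T (2%:M : 'M[R]_n).
have e1 : B = block_mx 1%:M 0 Q^T 1%:M *m block_mx 1%:M Q 0 (2%:M - Q^T *m Q).
  by rewrite mulmx_block !mul0mx !mul1mx !mulmx1 !addr0 addrC subrK.
have e2 : B *m block_mx 2%:M 0 (- Q^T) 1%:M = block_mx 1%:M Q 0 2%:M.
  rewrite /B mulmx_block !mulmx0 !mul1mx !mulmx1 !add0r mulmxN QQ.
  rewrite mul_scalar_mx mul_mx_scalar scalerN subrr.
  congr (block_mx _ _ _ _); apply/matrixP => i j; rewrite !mxE -mulrnBl.
  by rewrite -[1 in RHS]/(1%:R) -[2]/(1 + 1) addrK.
have := congr1 determinant e2.
rewrite det_mulmx det_ublock det_lblock e1 det_mulmx det_lblock det_ublock.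
by rewrite !det1 !mul1r !mulr1 !det_scalar.
Qed.

Lemma enorm_proj k n (Q : 'M[R]_(k, n)) (a : 'rV_n) : Q *m Q^T = 1%:M ->
  enorm (a - a *m Q^T *m Q) <= enorm a.
Proof.
move=> QQ; rewrite ler_wsqrtr//.
have -> : (a - a *m Q^T *m Q) *m (a - a *m Q^T *m Q)^T =
    a *m a^T - (a *m Q^T) *m (a *m Q^T)^T.
  rewrite linearB/= !trmx_mul !trmxK mulmxBl !mulmxBr !mulmxA.
  rewrite -[a *m Q^T *m Q *m Q^T]mulmxA QQ mulmx1 subrr subr0.
  by [].
by rewrite [leLHS]mxE [X in _ + X]mxE lerBlDr lerDl dot_self_ge0.
Qed.

End Euclid.

(** [nrm] is a norm on [R^(2n)], bounded below by a multiple of the maximum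
    norm.  The matrices [M] with [contr M] are the operators of norm at most [1]
    from the Euclidean space [R^(2n)] to [R^(2n)] normed by [nrm]; vectors are
    rows, so that operators act on the right. *)
Section DvoretzkyRogers.
Variables (R : realType) (n : nat).
Let N := (n + n)%N.
Variable nrm : 'rV[R]_N -> R.
Hypothesis nrmD : forall a b : 'rV_N, nrm (a + b) <= nrm a + nrm b.
Hypothesis nrmZ : forall t (a : 'rV_N), nrm (t *: a) = `|t| * nrm a.
Variable d : R.
Hypothesis d0 : 0 < d.
Hypothesis nrm_coord : forall (a : 'rV_N) i, d * `|a 0 i| <= nrm a.

Let contr (M : 'M[R]_N) := forall a : 'rV_N, nrm (a *m M) <= enorm a.

Let dets := [set x | exists2 M, contr M & x = `|\det M|].

Let nrm_ge0 a : 0 <= nrm a.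
Proof.
have h : nrm 0 = 0 by rewrite -(scale0r 0) nrmZ normr0 mul0r.
have := nrmD a (-1 *: a); rewrite scaleN1r subrr h -scaleN1r nrmZ normrN1 mul1r.
by lra.
Qed.

Let dets_bounded : has_ubound dets.
Proof.
exists (\sum_(s : {perm 'I_N}) d^-1 ^+ N) => _ [M cM ->].
rewrite /determinant; apply: (le_trans (ler_norm_sum _ _ _)).
apply: ler_sum => s _; rewrite normrM normr_sign mul1r normr_prod.
rewrite -[X in _ ^+ X]card_ord -prodr_const; apply: ler_prod => i _.
rewrite normr_ge0/= -(mul1r d^-1) ler_pdivlMr// mulrC.
apply: le_trans (_ : nrm (row i M) <= 1).
  by apply: le_trans (nrm_coord _ (s i)); rewrite mxE.
by rewrite rowE (le_trans (cM _))// enorm_delta.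
Qed.

Let det_pos : exists2 M, contr M & 0 < `|\det M|.
Proof.
have [C C0 hC] : exists2 C, 0 < C & forall a, nrm a <= C * enorm a.
  exists (\sum_i nrm (delta_mx 0 i) + 1).
    by rewrite ltr_pwDr// sumr_ge0// => i _; exact: nrm_ge0.
  move=> a; rewrite mulrDl mul1r -[leLHS]addr0 lerD ?enorm_ge0//.
  rewrite {1}(row_sum_delta a) mulr_suml.
  have : nrm (\sum_j a 0 j *: delta_mx 0 j) <=
      \sum_j `|a 0 j| * nrm (delta_mx 0 j).
    elim/big_ind2 : _ => //.
    - by rewrite -(scale0r 0) nrmZ normr0 mul0r.
    - by move=> x1 x2 y1 y2 h1 h2; rewrite (le_trans (nrmD _ _))// lerD.
    - by move=> i _; rewrite nrmZ.
  move=> /le_trans; apply; apply: ler_sum => i _; rewrite mulrC.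
  rewrite ler_wpM2l//.
  rewrite -sqrtr_sqr ler_wsqrtr// dot_self (bigD1 i)//= lerDl.
  by rewrite sumr_ge0// => j _; rewrite sqr_ge0.
exists (C^-1%:M).
  move=> a; rewrite mul_mx_scalar nrmZ gtr0_norm ?invr_gt0//.
  by rewrite mulrC ler_pdivrMr// mulrC hC.
by rewrite det_scalar normr_gt0 expf_neq0// invr_eq0 gt_eqF.
Qed.

(* An operator that almost maximizes the determinant, so that no compactness is
   needed; the loss 49/50 satisfies (7/5)^2 = 2 * (49/50). *)
Let near_max : exists M, [/\ contr M, 0 < `|\det M| &
  forall M', contr M' -> `|\det M'| * (49 / 50) ^+ n <= `|\det M|].
Proof.
have [M0 cM0 M00] := det_pos.
have hs : has_sup dets by split => //; exists `|\det M0|, M0.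
have s0 : 0 < sup dets.
  by apply: lt_le_trans M00 _; apply: ub_le_sup => //; exists M0.
case: (posnP n) => [n0|n0].
  exists M0; split => // M' _.
  suff e (A : 'M[R]_N) : \det A = 1 by rewrite !e n0 expr0 mulr1.
  have N0 : N = 0%N by rewrite /N n0.
  by move: A; rewrite N0 => A; rewrite det_mx00.
have e0 : 0 < sup dets * (1 - (49 / 50) ^+ n).
  rewrite mulr_gt0// subr_gt0 exprn_ilt1 -?lt0n//; lra.
have [_ [M cM ->] hM] := sup_adherent e0 hs.
have hM' : sup dets * (49 / 50) ^+ n < `|\det M| by move: hM; lra.
have q0 : 0 < (49 / 50 : R) ^+ n by rewrite exprn_gt0//; lra.
exists M; split => //; first by rewrite (lt_trans _ hM')// mulr_gt0.
move=> M' cM'; apply: le_trans (ltW hM'); rewrite (ler_pM2r q0).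
by apply: ub_le_sup => //; exists M'.
Qed.

(** The Dvoretzky--Rogers lemma, in coordinates: there are [n] vectors of norm at
    least [2/5] that are dominated by an orthonormal system.  They are the images
    under [M] of orthonormal vectors, chosen one after the other: if [M] were
    small on the complement of the [k < n] vectors already chosen, then doubling
    it there would keep its norm at most [7/5] and multiply its determinant by
    [2^(2n-k)], against the near-maximality of [M]. *)
Lemma Dvoretzky_Rogers : exists B : 'M[R]_(n, N),
  (forall i, 2 / 5 <= nrm (row i B)) /\
  forall a, nrm (a *m B) <= enorm a.
Proof.
have [M [cM M0 hM]] := near_max.
suff /(_ n (leqnn n)) [Q [QQ hQ]] : forall k, (k <= n)%N ->
    exists Q : 'M[R]_(k, N), Q *m Q^T = 1%:M /\
      forall i, 2 / 5 <= nrm (row i Q *m M).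
  exists (Q *m M); split=> [i|a]; first by rewrite row_mul.
  rewrite mulmxA (le_trans (cM _))// /enorm trmx_mul mulmxA -(mulmxA a) QQ.
  by rewrite mulmx1.
elim=> [_|k IH kn].
  exists 0; split; last by case.
  by rewrite mul0mx; apply/matrixP; case.
have [Q [QQ hQ]] := IH (ltnW kn).
(* a unit vector orthogonal to the rows of Q on which M is not small *)
have [a [a1 aQ ha]] : exists a : 'rV_N,
    [/\ enorm a = 1, a *m Q^T = 0 & 2 / 5 <= nrm (a *m M)].
  apply: contrapT => hno.
  have small h : h *m Q^T = 0 -> nrm (h *m M) <= 2 / 5 * enorm h.
    move=> hQ0; have [h0|h0] := eqVneq (enorm h) 0.
      rewrite (enorm_eq0 h0) mul0mx -(scale0r 0) nrmZ normr0 mul0r.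
      by rewrite mulr_ge0 ?enorm_ge0//; lra.
    have hp : 0 < enorm h by rewrite lt_neqAle eq_sym h0 enorm_ge0.
    rewrite leNgt; apply/negP => hlt; apply: hno.
    exists ((enorm h)^-1 *: h); split.
    - by rewrite enormZ gtr0_norm ?invr_gt0// mulVf.
    - by rewrite -scalemxAl hQ0 scaler0.
    - rewrite -scalemxAl nrmZ gtr0_norm ?invr_gt0//.
      by rewrite [leRHS]mulrC ler_pdivlMr// ltW.
  (* M doubled on the orthogonal complement of the rows of Q, and renormalized *)
  pose M' := (5 / 7) *: ((2%:M - Q^T *m Q) *m M).
  have cM' : contr M'.
    move=> a; rewrite /M' -scalemxAr nrmZ gtr0_norm; last lra.
    rewrite mulmxA mulmxBr mul_mx_scalar mulmxA.
    set h := a - a *m Q^T *m Q.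
    have -> : 2 *: a - a *m Q^T *m Q = a + h by rewrite scaler_nat mulr2n -addrA.
    have hh : h *m Q^T = 0.
      by rewrite mulmxBl -[_ *m Q *m Q^T]mulmxA QQ mulmx1 subrr.
    have h1 := small _ hh; have h2 := enorm_proj a QQ.
    rewrite mulmxDl; have h3 := nrmD (a *m M) (h *m M); have h4 := cM a.
    by rewrite -/h in h2; lra.
  have := hM _ cM'; rewrite /M' detZ normrM det_mulmx normrM.
  have q2 : (0 : R) < 2 ^+ k by rewrite exprn_gt0.
  have -> : \det (2%:M - Q^T *m Q) = 2 ^+ n * 2 ^+ (n - k).
    apply: (mulIf (lt0r_neq0 q2)); rewrite det_two_sub_proj//.
    by rewrite -mulrA -exprD subnK 1?ltnW// /N exprD.
  move: M0; set D := `|\det M| => D0.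
  rewrite /N exprD !normrM !normrX !gtr0_norm ?invr_gt0//.
  have -> : forall x : R, (5 / 7) ^+ n * (5 / 7) ^+ n * (2 ^+ n * 2 ^+ (n - k) * x)
      * (49 / 50) ^+ n = 2 ^+ (n - k) * x.
    move=> x; have e : (5 / 7 * (5 / 7) * 2 * (49 / 50)) ^+ n = 1 :> R.
      by rewrite [X in X ^+ n](_ : _ = 1) ?expr1n//; field.
    rewrite -[RHS]mul1r -[X in _ = X * _]e !exprMn.
    set a := 5 ^+ n; set b := 7^-1 ^+ n; set c := 2 ^+ n; set u := 49 ^+ n.
    by set v := 50^-1 ^+ n; set w := 2 ^+ _; ring.
  rewrite -[leRHS]mul1r ler_pM2r//; apply/negP; rewrite -ltNge.
  by rewrite exprn_egt1 ?subn_eq0 -?ltnNge// ltr1n.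
have e : k.+1 = (k + 1)%N by rewrite addn1.
rewrite e; exists (col_mx Q a); split.
  rewrite tr_col_mx mul_col_row QQ aQ.
  have -> : Q *m a^T = 0 by rewrite -[Q]trmxK -trmx_mul aQ trmx0.
  have -> : a *m a^T = 1%:M.
    rewrite [LHS]mx11_scalar; congr (_ %:M).
    move: a1 => /(congr1 (fun x => x ^+ 2)).
    by rewrite sqr_sqrtr ?dot_self_ge0// expr1n.
  by rewrite -scalar_mx_block.
move=> i; case: (split_ordP i) => j ->.
  by rewrite rowKu hQ.
by rewrite rowKd (ord1 j) row_id.
Qed.

End DvoretzkyRogers.

(** * The Hahn--Banach theorem for real vector spaces *)

Section HahnBanach.
Variables (R : realType) (V : lmodType R).

(** Sublinear functionals: subadditive and positively homogeneous *)
Definition sublinear_fun (q : V -> R) :=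
  (forall x y, q (x + y) <= q x + q y) /\
  (forall t x, 0 <= t -> q (t *: x) = t * q x).

Lemma sublinear_fun0 q : sublinear_fun q -> q 0 = 0.
Proof. by move=> [_ h]; rewrite -(scale0r 0) h// mul0r. Qed.

Lemma sublinear_lower q x : sublinear_fun q -> - q (- x) <= q x.
Proof.
move=> sq; have [hD _] := sq.
by have := hD x (- x); rewrite subrr sublinear_fun0//; lra.
Qed.

Lemma sublinear_intro q : (forall x y, q (x + y) <= q x + q y) -> q 0 = 0 ->
  (forall t x, 0 < t -> q (t *: x) <= t * q x) -> sublinear_fun q.
Proof.
move=> hD h0 hZ; split=> // t x; rewrite le_eqVlt => /predU1P[<-|t0].
  by rewrite scale0r h0 mul0r.
apply/eqP; rewrite eq_le hZ//= -ler_pdivlMl//.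
by rewrite -[X in q X <= _](scalerK (lt0r_neq0 t0)) hZ// invr_gt0.
Qed.

(* The pointwise infimum of a family F of functions *)
Let infF (I : Type) (F : I -> V -> R) x := inf (range (fun i => F i x)).

Let infF_le (I : Type) (F : I -> V -> R) (L : V -> R) :
  (forall i x, L x <= F i x) -> forall i x, infF F x <= F i x.
Proof.
move=> h i x; apply: ge_inf; last by exists i.
by exists (L x) => _ [j _ <-]; exact: h.
Qed.

Let le_infF (I : Type) (F : I -> V -> R) (i0 : I) x c :
  (forall i, c <= F i x) -> c <= infF F x.
Proof.
move=> h; apply: lb_le_inf; first by exists (F i0 x), i0.
by move=> _ [j _ <-]; exact: h.
Qed.

Variable p : V -> R.
Hypothesis sp : sublinear_fun p.

Let T := {q : V -> R | sublinear_fun q /\ forall x, q x <= p x}.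

Let chain_bound (A : set T) :
  total_on A (fun q1 q2 : T => `[< forall x, sval q2 x <= sval q1 x >]) ->
  exists t : T, forall s, A s -> forall x, sval t x <= sval s x.
Proof.
move=> Atot; have [[a Aa]|A0] := pselect (exists a, A a); last first.
  exists (exist _ p (conj sp (fun x => lexx (p x)))) => s As.
  by case: A0; exists s.
pose I := {s : T | A s}; pose F (i : I) := sval (sval i).
have sF i : sublinear_fun (F i) := proj1 (svalP (sval i)).
have Fp i x : F i x <= p x := proj2 (svalP (sval i)) x.
have Flow i x : - p (- x) <= F i x.
  by apply: le_trans (sublinear_lower x (sF i)); rewrite lerN2 Fp.
have Fle := infF_le Flow; have i0 : I := exist _ a Aa.
have lF := le_infF i0.
suff sm : sublinear_fun (infF F).
  have mp x : infF F x <= p x by rewrite (le_trans (Fle i0 x)).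
  exists (exist _ (infF F) (conj sm mp)) => s As x.
  exact: (Fle (exist _ s As)).
apply: sublinear_intro.
- move=> x y; rewrite -lerBlDr; apply: (lF) => i.
  rewrite lerBlDr -lerBlDl; apply: (lF) => j; rewrite lerBlDl.
  have /orP[ij|ji] : (`[< forall x, F i x <= F j x >] ||
                      `[< forall x, F j x <= F i x >]).
    by have [->|->] := Atot _ _ (svalP j) (svalP i); rewrite ?orbT.
  + apply: le_trans (Fle i _) _; apply: le_trans ((sF i).1 _ _) _.
    by rewrite lerD2l; move/asboolP : ij; exact.
  + apply: le_trans (Fle j _) _; apply: le_trans ((sF j).1 _ _) _.
    by rewrite lerD2r; move/asboolP : ji; exact.
- apply/eqP; rewrite eq_le; apply/andP; split.
    by rewrite (le_trans (Fle i0 0))// sublinear_fun0.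
  by apply: (lF) => i; rewrite sublinear_fun0.
- move=> t x t0; rewrite -ler_pdivrMl//; apply: (lF) => i.
  rewrite ler_pdivrMl//; apply: le_trans (Fle i _) _.
  by rewrite (sF i).2// ltW.
Qed.

(** Every sublinear functional dominates a minimal one. *)
Lemma minimal_sublinear : exists m, [/\ sublinear_fun m, forall x, m x <= p x &
  forall q, sublinear_fun q -> (forall x, q x <= m x) -> forall x, q x = m x].
Proof.
have [||||[m [sm mp]] hm] := @Zorn T
    (fun q1 q2 : T => `[< forall x, sval q2 x <= sval q1 x >]).
- by move=> t; apply/asboolP.
- move=> r s t /asboolP h1 /asboolP h2; apply/asboolP => x.
  exact: le_trans (h1 x).
- move=> [s hs] [t ht] /asboolP /= h1 /asboolP /= h2; apply: eq_exist => /=.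
  by apply/funext => x; apply/eqP; rewrite eq_le h1 h2.
- move=> A /chain_bound[t ht]; exists t => s As; apply/asboolP; exact: ht.
- exists m; split=> // q sq qm x.
  have qp y : q y <= p y by rewrite (le_trans (qm y)).
  have e := hm (exist _ q (conj sq qp)) (introT (asboolP _) qm).
  by rewrite -[q]/(sval (exist _ q (conj sq qp) : T)) e.
Qed.

(** A sublinear functional [q] dominates one that takes at [- y] a value at most
    [- q y], namely the infimum over [t >= 0] of [q (x + t y) - t q y].  So a
    minimal sublinear functional is odd, hence linear. *)
Lemma sublinear_deform q y : sublinear_fun q -> exists q', [/\ sublinear_fun q',
  forall x, q' x <= q x & q' (- y) <= - q y].
Proof.
move=> sq; have [qD qZ] := sq.
pose I := {t : R | 0 <= t}.
pose F (t : I) x := q (x + sval t *: y) - sval t * q y.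
have t0 : I := exist _ 0 (lexx 0).
have Flow t x : - q (- x) <= F t x.
  case: t => t ht; rewrite /F/= -qZ//.
  by have := qD (- x) (x + t *: y); rewrite addKr; lra.
have Fle := infF_le Flow; have lF := le_infF t0.
exists (infF F); split.
- apply: sublinear_intro.
  + move=> x x'; rewrite -lerBlDr; apply: (lF) => -[t ht].
    rewrite lerBlDr -lerBlDl; apply: (lF) => -[s hs]; rewrite lerBlDl.
    have hts : 0 <= t + s by rewrite addr_ge0.
    apply: le_trans (Fle (exist _ (t + s) hts) _) _; rewrite /F/=.
    by have := qD (x + t *: y) (x' + s *: y); rewrite scalerDl addrACA; lra.
  + apply/eqP; rewrite eq_le; apply/andP; split.
      apply: le_trans (Fle (exist _ 0 (lexx 0)) _) _.
      by rewrite /F/= scale0r mul0r subr0 addr0 sublinear_fun0.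
    by apply: (lF) => -[t ht]; rewrite /F/= add0r qZ// subrr.
  + move=> s x s0; rewrite -ler_pdivrMl//; apply: (lF) => -[t ht].
    rewrite ler_pdivrMl//.
    have hst : 0 <= s * t by rewrite mulr_ge0// ltW.
    apply: le_trans (Fle (exist _ (s * t) hst) _) _; rewrite /F/=.
    by rewrite -scalerA -scalerDr qZ ?(ltW s0)// mulrBr mulrA.
- move=> x; apply: le_trans (Fle (exist _ 0 (lexx 0)) _) _.
  by rewrite /F/= scale0r mul0r subr0 addr0.
- apply: le_trans (Fle (exist _ 1 ler01) _) _.
  by rewrite /F/= scale1r addNr mul1r sublinear_fun0// sub0r.
Qed.

End HahnBanach.

(** Hahn--Banach: a sublinear functional dominates a linear functional with
    the same value at a given point. *)
Lemma Hahn_Banach (R : realType) (V : lmodType R) (p : V -> R) (v0 : V) :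
  sublinear_fun p -> exists g : V -> R,
  [/\ forall x y, g (x + y) = g x + g y, forall t x, g (t *: x) = t * g x,
      forall x, g x <= p x & g v0 = p v0].
Proof.
move=> sp; have [p' [sp' p'p p'v]] := sublinear_deform v0 sp.
have [g [sg gp' gmin]] := minimal_sublinear sp'.
have [gD gZ] := sg.
have gN x : g (- x) = - g x.
  apply/eqP; rewrite eq_le; apply/andP; split.
    have [q [sq qg qx]] := sublinear_deform x sg.
    by rewrite -(gmin q sq qg).
  by rewrite lerNl sublinear_lower.
have gD' x y : g (x + y) = g x + g y.
  apply/eqP; rewrite eq_le gD/=.
  by have := gD (x + y) (- y); rewrite addrK gN; lra.
exists g; split=> //.
- move=> t x; have [t0|t0] := leP 0 t; first exact: gZ.
  by rewrite -[t]opprK scaleNr gN gZ ?mulNr// oppr_ge0 ltW.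
- by move=> x; rewrite (le_trans (gp' x)).
- apply/eqP; rewrite eq_le (le_trans (gp' _))//=.
  by have := le_trans (gp' (- v0)) p'v; rewrite gN lerN2.
Qed.

(** * Scalars, norms and norming functionals *)

Section Scalars.
Variables (R : realType) (k : scalar_kind).
Local Notation K := (scalar_field R k).

(** The inclusion of the real numbers in the scalar field *)
Definition real_scalar : {rmorphism R -> K} :=
  match k return {rmorphism R -> scalar_field R k} with
  | RealScalars => idfun
  | ComplexScalars => real_complex R
  end.

(** The second real coordinate of a scalar, which is [0] over the reals *)
Definition scalar_Im : K -> R :=
  match k return scalar_field R k -> R with
  | RealScalars => fun=> 0
  | ComplexScalars => @complex.Im R
  end.

(** The imaginary unit over the complex numbers, [0] over the reals *)
Definition scalar_i : K :=
  match k return scalar_field R k with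
  | RealScalars => 0
  | ComplexScalars => Complex 0 1
  end.

(** The absolute value of a scalar, as a real number *)
Definition modulus (c : K) : R := scalar_Re `|c|.

Lemma real_scalarK r : scalar_Re (real_scalar r) = r.
Proof. by rewrite /real_scalar; case: k. Qed.

Lemma ler_real_scalar r s : (real_scalar r <= real_scalar s) = (r <= s).
Proof. by rewrite /real_scalar; case: k => //=; exact: lecR. Qed.

Lemma ltr_real_scalar r s : (real_scalar r < real_scalar s) = (r < s).
Proof. by rewrite !lt_def ler_real_scalar (inj_eq (can_inj real_scalarK)). Qed.

Lemma real_scalar_Re (c : K) : 0 <= c -> real_scalar (scalar_Re c) = c.
Proof.
rewrite /real_scalar; case: k c => //= c c0.
by apply: RRe_real; exact: ger0_real.
Qed.

Lemma modulus_real r : modulus (real_scalar r) = `|r|.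
Proof.
rewrite /modulus /real_scalar; case: k => //.
rewrite -[LHS]/(complex.Re `|real_complex R r|) normc_def/=.
by rewrite expr0n addr0 sqrtr_sqr.
Qed.

Lemma modulusE (c : K) : `|c| = real_scalar (modulus c).
Proof. by rewrite /modulus real_scalar_Re. Qed.

Lemma modulus_ge0 (c : K) : 0 <= modulus c.
Proof. by rewrite -ler_real_scalar -modulusE rmorph0. Qed.

Lemma modulusM (c d : K) : modulus (c * d) = modulus c * modulus d.
Proof.
apply: (can_inj real_scalarK).
by rewrite rmorphM/= -!modulusE normrM.
Qed.

Lemma modulusD (c d : K) : modulus (c + d) <= modulus c + modulus d.
Proof.
by rewrite -ler_real_scalar rmorphD/= -!modulusE; exact: ler_normD.
Qed.

Lemma modulus0 : modulus (0 : K) = 0.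
Proof. by rewrite -(rmorph0 real_scalar) modulus_real normr0. Qed.

Lemma modulus1 : modulus (1 : K) = 1.
Proof. by rewrite -(rmorph1 real_scalar) modulus_real normr1. Qed.

Lemma modulus_sign (b : bool) : modulus ((-1) ^+ b : K) = 1.
Proof. by rewrite -modulus1 /modulus normrX normrN1 expr1n normr1. Qed.

Lemma modulus_eq0 (c : K) : modulus c = 0 -> c = 0.
Proof.
by move=> h; apply/eqP; rewrite -normr_eq0 modulusE h rmorph0.
Qed.

Lemma scalar_decomp (c : K) :
  c = real_scalar (scalar_Re c) + scalar_i * real_scalar (scalar_Im c).
Proof.
rewrite /real_scalar /scalar_i /scalar_Im; case: k c => [c|c] /=.
  by rewrite mul0r addr0.
exact: complexE.
Qed.

Lemma modulus_sqr (c : K) : modulus c ^+ 2 = scalar_Re c ^+ 2 + scalar_Im c ^+ 2.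
Proof.
rewrite /modulus /scalar_Im; case: k c => [c|c].
  by rewrite /= expr0n addr0 real_normK ?num_real.
rewrite -[`|c|]/(`|c : R[i]|) normc_def/= sqr_sqrtr// addr_ge0// sqr_ge0//.
Qed.

Lemma modulus_i : modulus scalar_i <= 1.
Proof.
rewrite /modulus /scalar_i; case: k => [|]; first by rewrite /= normr0.
rewrite -[`|_|]/(`|Complex 0 1 : R[i]|) normc_def/= expr0n expr1n add0r.
by rewrite sqrtr1.
Qed.

(** The scalar of modulus at most [1] that rotates [c] to its modulus; it is [0]
    for [c = 0]. *)
Definition phase (c : K) : K := real_scalar (modulus c) / c.

Lemma phaseM (c : K) : phase c * c = real_scalar (modulus c).
Proof.
rewrite /phase; have [->|c0] := eqVneq c 0; last by rewrite divfK.
by rewrite mulr0 modulus0 rmorph0.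
Qed.

Lemma modulus_phase (c : K) : modulus (phase c) <= 1.
Proof.
have [->|c0] := eqVneq c 0.
  by rewrite /phase invr0 mulr0 modulus0 ler01.
have m0 : 0 < modulus c.
  rewrite lt_neqAle modulus_ge0 eq_sym andbT.
  by apply: contra_neq c0 => /modulus_eq0.
rewrite -(ler_pM2r m0) -modulusM phaseM modulus_real mul1r ger0_norm//.
exact: modulus_ge0.
Qed.

Section Norm.
Variable X : normedModType K.
Implicit Types x y : X.

Lemma rnormE x : `|x| = real_scalar (rnorm x).
Proof. by rewrite /rnorm real_scalar_Re. Qed.

Lemma rnorm_ge0 x : 0 <= rnorm x.
Proof. by rewrite -ler_real_scalar -rnormE rmorph0. Qed.

Lemma rnormD x y : rnorm (x + y) <= rnorm x + rnorm y.
Proof.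
by rewrite -ler_real_scalar rmorphD/= -!rnormE; exact: ler_normD.
Qed.

Lemma rnormZ c x : rnorm (c *: x) = modulus c * rnorm x.
Proof.
apply: (can_inj real_scalarK).
by rewrite rmorphM/= -!rnormE -modulusE normrZ.
Qed.

Lemma rnormZr r x : rnorm (real_scalar r *: x) = `|r| * rnorm x.
Proof. by rewrite rnormZ modulus_real. Qed.

Lemma rnorm0 : rnorm (0 : X) = 0.
Proof. by rewrite -(scale0r 0) rnormZ modulus0 mul0r. Qed.

Lemma rnormN x : rnorm (- x) = rnorm x.
Proof. by rewrite /rnorm normrN. Qed.

Lemma rnorm_eq0 x : rnorm x = 0 -> x = 0.
Proof. by move=> h; apply/eqP; rewrite -normr_eq0 rnormE h rmorph0. Qed.

Lemma rnorm_sum (I : Type) (r : seq I) (P : pred I) (F : I -> X) :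
  rnorm (\sum_(i <- r | P i) F i) <= \sum_(i <- r | P i) rnorm (F i).
Proof.
elim/big_ind2 : _ => //; first by rewrite rnorm0.
by move=> x1 x2 y1 y2 h1 h2; rewrite (le_trans (rnormD _ _))// lerD.
Qed.

End Norm.

(** A module over the scalar field, seen as a real vector space *)
Definition realification (X : lmodType K) : Type := X.

HB.instance Definition _ (X : lmodType K) := GRing.Zmodule.on (realification X).

Section Realification.
Variable X : lmodType K.
Let scale (r : R) (x : realification X) : realification X :=
  real_scalar r *: (x : X).

Let scaleA a b v : scale a (scale b v) = scale (a * b) v.
Proof. by rewrite /scale scalerA rmorphM. Qed.
Let scale1 : left_id 1 scale.
Proof. by move=> v; rewrite /scale rmorph1 scale1r. Qed.
Let scaleDr : right_distributive scale +%R.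
Proof. by move=> a u v; rewrite /scale scalerDr. Qed.
Let scaleDl v : {morph scale^~ v : a b / a + b}.
Proof. by move=> a b; rewrite /scale rmorphD scalerDl. Qed.

HB.instance Definition _ := GRing.Zmodule_isLmodule.Build R (realification X)
  scaleA scale1 scaleDr scaleDl.
End Realification.

Lemma realificationZ (X : lmodType K) r (x : X) :
  r *: (x : realification X) = real_scalar r *: x.
Proof. by []. Qed.

End Scalars.

(** A linear form given by a function and a proof of its linearity *)
Definition pack_scalar (K : fieldType) (X : lmodType K) (f : X -> K)
    (lf : scalar f) : {scalar X} :=
  HB.pack f (GRing.isLinear.Build _ _ _ _ _ lf).

(** A real-linear functional [g] is the real part of a linear one, which over the
    complex numbers is [g x - i g (i x)]. *)
Lemma real_part_functional (R : realType) (k : scalar_kind)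
    (X : lmodType (scalar_field R k)) (g : X -> R) :
  (forall x y, g (x + y) = g x + g y) ->
  (forall t x, g (real_scalar R k t *: x) = t * g x) ->
  exists phi : {scalar X}, forall x, scalar_Re (phi x) = g x.
Proof.
case: k X g => X g gD gZ.
  have lg : scalar (g : X -> R^o) by move=> a x y; rewrite gD gZ.
  by exists (pack_scalar lg).
pose f (x : X) : R[i] := Complex (g x) (- g (Complex 0 1 *: x)).
have gZ' t x : g (real_complex R t *: x) = t * g x := gZ t x.
have fD x y : f (x + y) = f x + f y.
  by rewrite /f scalerDr !gD opprD.
have fR t x : f (real_complex R t *: x) = real_complex R t * f x.
  rewrite /f gZ' scalerA (mulrC (Complex 0 1)) -scalerA gZ'.
  by apply/eqP; rewrite eq_complex /= !mul0r subr0 addr0 mulrN !eqxx.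
have fi x : f (Complex 0 1 *: x) = Complex 0 1 * f x.
  rewrite /f scalerA -expr2 sqr_i scaleN1r.
  have gN y : g (- y) = - g y.
    have e : - y = real_complex R (-1) *: y by rewrite rmorphN1 scaleN1r.
    by rewrite e gZ' mulN1r.
  apply/eqP.
  by rewrite eq_complex /= gN !mul0r !mul1r !opprK !add0r !eqxx.
have lf : scalar f.
  move=> a x y; rewrite fD; congr (_ + _).
  rewrite {1}(complexE a) scalerDl fD -scalerA fR fi fR.
  by rewrite mulrA -mulrDl -complexE.
by exists (pack_scalar lf).
Qed.

(** Hahn--Banach: every vector has a norming functional. *)
Lemma norming_functional (R : realType) (k : scalar_kind)
    (X : normedModType (scalar_field R k)) (v : X) :
  exists phi : {scalar X}, (forall x, modulus (phi x) <= rnorm x) /\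
    phi v = real_scalar R k (rnorm v).
Proof.
have sp : @sublinear_fun R (realification X) (@rnorm R k X).
  split; first exact: rnormD.
  by move=> t x t0; rewrite realificationZ rnormZr ger0_norm.
have [g [gD gZ gle gv]] := @Hahn_Banach R (realification X) _ v sp.
have [phi hphi] := @real_part_functional R k X g gD gZ.
have phile x : modulus (phi x) <= rnorm x.
  have <- : scalar_Re (phi (phase (phi x) *: x)) = modulus (phi x).
    by rewrite linearZ/= phaseM real_scalarK.
  rewrite hphi (le_trans (gle _))// rnormZ ler_piMl ?rnorm_ge0//.
  exact: modulus_phase.
exists phi; split=> //.
have hRe : scalar_Re (phi v) = rnorm v by rewrite hphi.
have hIm : scalar_Im (phi v) = 0.
  have := modulus_sqr (phi v); rewrite hRe => h.
  have : modulus (phi v) ^+ 2 <= rnorm v ^+ 2.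
    by rewrite ler_sqr ?nnegrE ?modulus_ge0 ?rnorm_ge0.
  rewrite h gerDl => h2; apply/eqP.
  by rewrite -sqrf_eq0 eq_le h2 sqr_ge0.
by rewrite [LHS]scalar_decomp hRe hIm rmorph0 mulr0 addr0.
Qed.

(** * Biorthogonal systems and the Dvoretzky--Rogers lemma in normed spaces *)

Section Families.
Variables (R : realType) (k : scalar_kind).
Local Notation K := (scalar_field R k).
Local Notation "t %:K" := (real_scalar R k t) (at level 2, format "t %:K").
Implicit Type X Y : normedModType K.

(** In an infinite-dimensional space there are arbitrarily long biorthogonal
    systems of vectors and bounded functionals. *)
Lemma biorthogonal X (N : nat) : infinite_dimensional X ->
  exists (f : nat -> X) (chi : nat -> {scalar X}) (C : R),
  [/\ 0 <= C, forall i x, (i < N)%N -> modulus (chi i x) <= C * rnorm x &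
    forall i j, (i < N)%N -> (j < N)%N -> chi i (f j) = (i == j)%:R].
Proof.
move=> hX; elim: N => [|N [f [chi [C [C0 chiC chif]]]]].
  have [phi _] := norming_functional (0 : X).
  by exists (fun=> 0), (fun=> phi), 0; split.
(* otherwise the vectors f i would span the space *)
have [v v0 chiv] : exists2 v : X, v != 0 & forall i, (i < N)%N -> chi i v = 0.
  apply: contrapT => hno; apply: hX; exists N, (fun i => f i) => v.
  exists (fun i => chi i v); apply/eqP; rewrite -subr_eq0.
  apply: contrapT => /negP hv; apply: hno; eexists; first exact: hv.
  move=> j jN; rewrite linearB/= linear_sum/= (bigD1 (Ordinal jN))//=.
  rewrite linearZ/= chif// eqxx mulr1 big1 ?addr0 ?subrr// => i ij.
  rewrite linearZ/= chif// -[_ == _]/(Ordinal jN == i) eq_sym (negPf ij).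
  by rewrite mulr0.
have [phi [phile phiv]] := norming_functional v.
have rv0 : rnorm v != 0 by apply: contra_neq v0 => /rnorm_eq0.
(* the projection to the common kernel of the functionals already chosen, along
   the vectors already chosen *)
pose pr x := x - \sum_(i < N) chi i x *: f i.
have prlin a x y : pr (a *: x + y) = a *: pr x + pr y.
  rewrite /pr scalerBr scaler_sumr addrACA -opprD -big_split/=.
  congr (_ - _); apply: eq_bigr => i _.
  by rewrite linearP/= scalerDl scalerA.
have pr_le x : rnorm (pr x) <= (1 + \sum_(i < N) C * rnorm (f i)) * rnorm x.
  rewrite mulrDl mul1r (le_trans (rnormD _ _))// rnormN lerD2l mulr_suml.
  rewrite (le_trans (rnorm_sum _ _ _))// ler_sum// => i _.
  by rewrite rnormZ mulrAC ler_wpM2r ?rnorm_ge0 ?chiC.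
have lg : scalar (fun x => (rnorm v)^-1%:K * phi (pr x)).
  by move=> a x y; rewrite prlin linearP/= mulrDr mulrCA.
pose g := pack_scalar lg.
have gE x : g x = (rnorm v)^-1%:K * phi (pr x) by [].
pose S := `|(rnorm v)^-1| * (1 + \sum_(i < N) C * rnorm (f i)).
have S0 : 0 <= S.
  rewrite mulr_ge0// addr_ge0// sumr_ge0// => i _.
  by rewrite mulr_ge0// rnorm_ge0.
exists (fun i => if (i < N)%N then f i else v),
  (fun i => if (i < N)%N then chi i else g), (C + S).
split; first by rewrite addr_ge0.
- move=> i x _; case: ifP => iN.
    rewrite (le_trans (chiC i x iN))// ler_wpM2r ?rnorm_ge0//.
    by rewrite lerDl.
  rewrite gE modulusM modulus_real mulrDl -mulrA ler_wpDl//.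
    by rewrite mulr_ge0 ?rnorm_ge0.
  by rewrite ler_wpM2l// (le_trans (phile _)).
- have prf j : (j < N)%N -> pr (f j) = 0.
    move=> jN; rewrite /pr (bigD1 (Ordinal jN))//= chif// eqxx scale1r.
    rewrite big1 ?addr0 ?subrr// => i ij.
    by rewrite chif// -[_ == _]/(i == Ordinal jN) (negPf ij) scale0r.
  have prv : pr v = v.
    by rewrite /pr big1 ?subr0// => i _; rewrite chiv// scale0r.
  move=> i j; rewrite !ltnS => iN jN.
  case: ltnP => iN'; case: ltnP => jN'.
  + exact: chif.
  + by rewrite chiv// ltn_eqF// (leq_trans iN').
  + by rewrite gE prf// linear0 mulr0 gtn_eqF// (leq_trans jN').
  + rewrite gE prv phiv -rmorphM/= mulVf// rmorph1.
    by rewrite (@anti_leq i N) ?iN// (@anti_leq j N) ?jN// eqxx.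
Qed.

(** A bound for combinations with real coefficients gives, up to a factor [2], one
    for combinations with arbitrary scalars. *)
Lemma real_to_scalar_bound Y n (y : 'I_n -> Y) (M : R) : 0 <= M ->
  (forall a : 'rV[R]_n, rnorm (\sum_i (a 0 i)%:K *: y i) <= M * enorm a) ->
  forall c : 'I_n -> K,
    rnorm (\sum_i c i *: y i) <= 2 * M * Num.sqrt (\sum_i modulus (c i) ^+ 2).
Proof.
move=> M0 h c.
have hle (u : K -> R) : (forall z, u z ^+ 2 <= modulus z ^+ 2) ->
    rnorm (\sum_i (u (c i))%:K *: y i) <=
      M * Num.sqrt (\sum_i modulus (c i) ^+ 2).
  move=> hu; have := h (\row_i u (c i)).
  under eq_bigr do rewrite mxE.
  move=> /le_trans; apply; rewrite ler_wpM2l// ler_wsqrtr// dot_self.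
  by apply: ler_sum => i _; rewrite mxE.
have -> : \sum_i c i *: y i = \sum_i (scalar_Re (c i))%:K *: y i +
    scalar_i R k *: \sum_i (scalar_Im (c i))%:K *: y i.
  rewrite scaler_sumr -big_split/=; apply: eq_bigr => i _.
  by rewrite {1}(scalar_decomp (c i)) scalerDl scalerA.
rewrite -mulrA mulr_natl mulr2n (le_trans (rnormD _ _))// lerD//.
  by apply: hle => z; rewrite modulus_sqr lerDl sqr_ge0.
rewrite rnormZ; apply: le_trans (hle (@scalar_Im R k) _).
  by rewrite ler_piMl ?rnorm_ge0// modulus_i.
by move=> z; rewrite modulus_sqr lerDr sqr_ge0.
Qed.

(** The Dvoretzky--Rogers lemma in an infinite-dimensional normed space *)
Lemma Dvoretzky_Rogers_space X n : infinite_dimensional X ->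
  exists y : 'I_n -> X, (forall i, 2 / 5 <= rnorm (y i)) /\
  forall c : 'I_n -> K,
    rnorm (\sum_i c i *: y i) <= 2 * Num.sqrt (\sum_i modulus (c i) ^+ 2).
Proof.
move=> hX.
have [f [chi [C [C0 chiC chif]]]] := @biorthogonal X (n + n) hX.
pose S (a : 'rV[R]_(n + n)) := \sum_(i < n + n) (a 0 i)%:K *: f i.
have SD a b : S (a + b) = S a + S b.
  rewrite /S -big_split; apply: eq_bigr => i _.
  by rewrite mxE rmorphD scalerDl.
have SZ t a : S (t *: a) = t%:K *: S a.
  rewrite /S scaler_sumr; apply: eq_bigr => i _.
  by rewrite mxE rmorphM scalerA.
have C1 : 0 < C + 1 by rewrite ltr_wpDl.
have [||||B [hB1 hB2]] :=
  @Dvoretzky_Rogers R n (fun a => rnorm (S a)) _ _ (C + 1)^-1.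
- by move=> a b; rewrite SD rnormD.
- by move=> t a; rewrite SZ rnormZr.
- by rewrite invr_gt0.
- move=> a i; rewrite ler_pdivrMl// -(modulus_real k).
  have -> : (a 0 i)%:K = chi i (S a).
    rewrite /S linear_sum (bigD1 i)//= linearZ/= chif// eqxx mulr1.
    rewrite big1 ?addr0// => j ji.
    by rewrite linearZ/= chif// -[_ == _]/(i == j) eq_sym (negPf ji) mulr0.
  rewrite (le_trans (chiC i _ _))// ler_wpM2r ?rnorm_ge0//.
  by rewrite lerDl.
exists (fun i => S (row i B)); split=> // c.
rewrite -[X in X * _]mulr1; apply: real_to_scalar_bound => // a.
rewrite mul1r; apply: le_trans (hB2 a).
suff -> : \sum_i (a 0 i)%:K *: S (row i B) = S (a *m B) by [].
rewrite mulmx_sum_row; elim/big_rec2 : _ => [|i u v _ ->].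
  by rewrite -(scale0r (0 : 'rV[R]_(n + n))) SZ rmorph0 scale0r.
by rewrite SD SZ.
Qed.

(** The Dvoretzky--Rogers lemma in the dual of an infinite-dimensional normed
    space: it is applied to the span of the functionals of a biorthogonal system,
    with the dual norm.  The points [z i] witness the lower bounds, and the last
    bound is the upper one, read in the bidual. *)
Lemma Dvoretzky_Rogers_dual X n : infinite_dimensional X ->
  exists (psi : 'I_n -> {scalar X}) (z : 'I_n -> X),
  [/\ forall i, rnorm (z i) <= 1, forall i, 1 / 3 <= modulus (psi i (z i)) &
    forall x, \sum_i modulus (psi i x) ^+ 2 <= (2 * rnorm x) ^+ 2].
Proof.
move=> hX.
have [f [chi [C [C0 chiC chif]]]] := @biorthogonal X (n + n) hX.
pose ev (a : 'rV[R]_(n + n)) x := \sum_(i < n + n) (a 0 i)%:K * chi i x.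
have evD a b x : ev (a + b) x = ev a x + ev b x.
  rewrite /ev -big_split; apply: eq_bigr => i _.
  by rewrite mxE rmorphD mulrDl.
have evZ t a x : ev (t *: a) x = t%:K * ev a x.
  rewrite /ev mulr_sumr; apply: eq_bigr => i _.
  by rewrite mxE rmorphM mulrA.
have evP a : scalar (ev a).
  move=> c x y; rewrite /ev mulr_sumr -big_split; apply: eq_bigr => i _.
  by rewrite linearP/= mulrDr mulrCA.
have evZr a c x : ev a (c *: x) = c * ev a x.
  exact: (linearZ_LR (pack_scalar (evP a))).
(* nrm is the dual norm of the functional ev a *)
pose ball a := [set modulus (ev a x) | x in [set x : X | rnorm x <= 1]].
pose nrm a := sup (ball a).
have ball_ub a : has_ubound (ball a).
  exists (\sum_(i < n + n) `|a 0 i| * C) => _ [x /= x1 <-].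
  apply: (@le_trans _ _ (\sum_(i < n + n) modulus ((a 0 i)%:K * chi i x))).
    rewrite /ev; elim/big_ind2 : _ => //; first by rewrite modulus0.
    by move=> ? ? ? ? h1 h2; rewrite (le_trans (modulusD _ _))// lerD.
  apply: ler_sum => i _; rewrite modulusM modulus_real ler_wpM2l//.
  by rewrite (le_trans (chiC i x _))// ler_piMr.
have ball0 a : ball a !=set0 by exists (modulus (ev a 0)), 0; rewrite //= rnorm0.
have nrm_ge a x : rnorm x <= 1 -> modulus (ev a x) <= nrm a.
  by move=> x1; apply: ub_le_sup => //; exists x.
have nrm_le a s :
    (forall x, rnorm x <= 1 -> modulus (ev a x) <= s) -> nrm a <= s.
  by move=> h; apply: ge_sup => // _ [x x1 <-]; exact: h.
have nrm_ge0 a : 0 <= nrm a.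
  by apply: le_trans (nrm_ge a 0 _); rewrite ?rnorm0 ?modulus_ge0.
have nrmZ_le t a : nrm (t *: a) <= `|t| * nrm a.
  by apply: nrm_le => x x1; rewrite evZ modulusM modulus_real ler_wpM2l// nrm_ge.
pose S := 1 + \sum_(i < n + n) rnorm (f i).
have S0 : 0 < S by rewrite ltr_pwDl// sumr_ge0// => i _; exact: rnorm_ge0.
have Si : `|S^-1| = S^-1 by rewrite gtr0_norm ?invr_gt0.
have [||||B [hB1 hB2]] := @Dvoretzky_Rogers R n nrm _ _ S^-1.
- move=> a b; apply: nrm_le => x x1; rewrite evD.
  by rewrite (le_trans (modulusD _ _))// lerD// nrm_ge.
- move=> t a; apply/eqP; rewrite eq_le nrmZ_le/=.
  have [->|t0] := eqVneq t 0; first by rewrite normr0 mul0r.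
  have := nrmZ_le t^-1 (t *: a); rewrite scalerK// normfV.
  by rewrite ler_pdivlMl// normr_gt0.
- by rewrite invr_gt0.
- move=> a i; have -> : S^-1 * `|a 0 i| = modulus (ev a (S^-1%:K *: f i)).
    rewrite evZr modulusM modulus_real Si -(modulus_real k).
    congr (_ * modulus _); rewrite /ev (bigD1 i)//= chif// eqxx mulr1.
    rewrite big1 ?addr0// => j ji.
    by rewrite chif// -[_ == _]/(j == i) (negPf ji) mulr0.
  apply: nrm_ge; rewrite rnormZr Si ler_pdivrMl// mulr1.
  rewrite /S (bigD1 i)//= addrCA lerDl addr_ge0// sumr_ge0// => j _.
  exact: rnorm_ge0.
have /choice[z hz] : forall i, exists z : X,
    rnorm z <= 1 /\ 1 / 3 <= modulus (ev (row i B) z).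
  move=> i; apply: contrapT => hno.
  have : nrm (row i B) <= 1 / 3.
    apply: nrm_le => x x1; rewrite leNgt; apply/negP => hx; apply: hno.
    by exists x; split=> //; exact: ltW.
  by have := hB1 i; lra.
have ev_le a x : modulus (ev a x) <= nrm a * rnorm x.
  have [x0|x0] := eqVneq (rnorm x) 0.
    by rewrite x0 mulr0 (rnorm_eq0 x0) -(scale0r 0) evZr mul0r modulus0.
  have xp : 0 < rnorm x by rewrite lt_neqAle eq_sym x0 rnorm_ge0.
  rewrite -ler_pdivrMr// mulrC -{1}[(rnorm x)^-1]gtr0_norm ?invr_gt0//.
  rewrite -(modulus_real k) -modulusM -evZr; apply: nrm_ge.
  by rewrite rnormZr gtr0_norm ?invr_gt0// mulVf.
exists (fun i => pack_scalar (evP (row i B))), z; split.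
- by move=> i; case: (hz i).
- by move=> i; case: (hz i).
move=> x; set s := \sum_i _.
have s0 : 0 <= s by rewrite sumr_ge0// => i _; rewrite sqr_ge0.
pose t i := ev (row i B) x.
have hbound := @real_to_scalar_bound K^o n t (rnorm x) (rnorm_ge0 x) _
  (fun i => (modulus (t i))%:K * phase (t i)).
suff hs : s <= 2 * rnorm x * Num.sqrt s.
  have [->|sn0] := eqVneq s 0; first by rewrite sqr_ge0.
  have sp : 0 < Num.sqrt s by rewrite sqrtr_gt0 lt_neqAle eq_sym sn0.
  move: hs; rewrite -{1}(sqr_sqrtr s0) expr2 ler_pM2r// => hs.
  rewrite -(sqr_sqrtr s0) ler_sqr ?nnegrE ?sqrtr_ge0//.
  by rewrite mulr_ge0 ?rnorm_ge0.
have e : rnorm (\sum_i (((modulus (t i))%:K * phase (t i)) *: (t i : K^o))) = s.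
  rewrite (_ : \sum_i _ = s%:K).
    exact: etrans (modulus_real _ _) (ger0_norm s0).
  rewrite /s rmorph_sum; apply: eq_bigr => i _.
  by rewrite -[_ *: _]/(_ * _) -mulrA phaseM -rmorphM.
rewrite -{1}e; apply: le_trans (hbound _) _.
  move=> a; rewrite mulrC.
  have -> : \sum_i (a 0 i)%:K *: (t i : K^o) = ev (a *m B) x.
    rewrite mulmx_sum_row; elim/big_rec2 : _ => [|i u v _ ->].
      by rewrite -(scale0r (0 : 'rV[R]_(n + n))) evZ rmorph0 mul0r.
    by rewrite evD evZ.
  apply: le_trans (ev_le _ _) _.
  by rewrite ler_wpM2r ?rnorm_ge0.
rewrite ler_wpM2l//; first by rewrite mulr_ge0 ?rnorm_ge0.
rewrite ler_wsqrtr// /s ler_sum// => i _.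
rewrite ler_sqr ?nnegrE ?modulus_ge0// modulusM modulus_real.
by rewrite ger0_norm ?modulus_ge0// ler_piMr ?modulus_ge0// modulus_phase.
Qed.

End Families.

(** * Random signs and small perturbations *)

(** For any [u j] and [v i j], flipping the sign of [v j j] turns a small sum
    at [j] into a large one; so on average half of the sums are large. *)
Lemma exists_good_signs (R : realType) (k : scalar_kind)
    (Y : normedModType (scalar_field R k)) (N : nat)
    (u : 'I_N -> Y) (v : 'I_N -> 'I_N -> Y) :
  exists eps : {ffun 'I_N -> bool},
    (N <= 2 * #|[pred j | (rnorm (v j j) <=
       rnorm (u j + \sum_i (-1) ^+ (eps i) *: v i j))%R]|)%N.
Proof.
pose good (eps : {ffun 'I_N -> bool}) j := rnorm (v j j) <=
  rnorm (u j + \sum_i (-1) ^+ (eps i) *: v i j).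
pose flip j (eps : {ffun 'I_N -> bool}) :=
  [ffun i => if i == j then ~~ eps i else eps i].
have flipK j : involutive (flip j).
  by move=> eps; apply/ffunP => i; rewrite !ffunE; case: eqP => // _; rewrite negbK.
have good_flip eps j : (1 <= good eps j + good (flip j eps) j)%N.
  rewrite addn_gt0 !lt0b -implyNb; apply/implyP; rewrite -ltNge => h.
  rewrite /good leNgt; apply/negP; move: h.
  rewrite (bigD1 j)//= [X in _ -> rnorm (_ + X) < _ -> _](bigD1 j)//=.
  have -> : \sum_(i < N | i != j) (-1) ^+ (flip j eps i) *: v i j =
            \sum_(i < N | i != j) (-1) ^+ (eps i) *: v i j.
    by apply: eq_bigr => i ij; rewrite ffunE (negPf ij).
  rewrite ffunE eqxx; set w := \sum_(_ < _ | _) _.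
  have -> : (-1) ^+ (~~ eps j) *: v j j = - ((-1) ^+ (eps j) *: v j j).
    by rewrite -scaleNr; case: (eps j); rewrite ?expr0 ?expr1 ?opprK.
  set s := (-1) ^+ eps j *: v j j.
  have -> : rnorm (v j j) = rnorm s.
    by rewrite /s rnormZ modulus_sign mul1r.
  have := rnormD (u j + (s + w)) (- (u j + (- s + w))); rewrite rnormN.
  have -> : u j + (s + w) - (u j + (- s + w)) = real_scalar R k 2 *: s.
    rewrite rmorph_nat scaler_nat mulr2n !opprD opprK.
    by rewrite addrACA subrr add0r addrACA subrr addr0.
  by rewrite rnormZr ger0_norm//; lra.
apply: contrapT => hno.
(* otherwise the pairs (eps, j) with eps good at j would be fewer than half of
   all pairs, while flipping the sign at j shows that they are at least half *)
have small eps : (2 * \sum_j good eps j < N)%N.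
  rewrite ltnNge; apply/negP => h; apply: hno; exists eps.
  by rewrite -sum1_card big_mkcond.
have hsum : (N * #|{ffun 'I_N -> bool}| <=
    \sum_(eps : {ffun 'I_N -> bool}) 2 * \sum_j good eps j)%N.
  rewrite -big_distrr/= exchange_big/= big_distrr/=.
  rewrite -[X in (X * _ <= _)%N]card_ord -sum_nat_const; apply: leq_sum => j _.
  rewrite mul2n -addnn.
  rewrite [X in (_ <= _ + X)%N](reindex_inj (inv_inj (flipK j)))/= -big_split/=.
  by rewrite -sum1_card; apply: leq_sum => eps _; exact: good_flip.
have : (\sum_(eps : {ffun 'I_N -> bool}) (2 * \sum_j good eps j).+1 <=
    \sum_(eps : {ffun 'I_N -> bool}) N)%N.
  by apply: leq_sum => eps _; exact: small.
under eq_bigr do rewrite -addn1.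
rewrite big_split/= sum1_card sum_nat_const mulnC.
move=> /(leq_trans (leq_add hsum (leqnn _))).
rewrite -[leqRHS]addn0 leq_add2l leqn0 => /eqP h0.
have : (0 < #|{ffun 'I_N -> bool}|)%N by apply/card_gt0P; exists [ffun=> true].
by rewrite h0.
Qed.

(** Bilinearity of a plain function of two arguments *)
Definition bilinear_map (K : fieldType) (X1 X2 Y : lmodType K)
    (A : X1 -> X2 -> Y) :=
  (forall b, linear (A^~ b)) /\ (forall a, linear (A a)).

Section Step.
Variables (R : realType) (k : scalar_kind).
Local Notation K := (scalar_field R k).
Local Notation "t %:K" := (real_scalar R k t) (at level 2, format "t %:K").
Variables X1 X2 Y : normedModType K.
Hypothesis hX1 : infinite_dimensional X1.
Hypothesis hX2 : infinite_dimensional X2.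
Hypothesis hY : infinite_dimensional Y.

(** Any map [P] becomes large at half of [N] suitable points [(x j, z j)] after
    adding a bilinear map [D] of norm at most [tau].  Here [D a b] is the sum of
    [(tau / 4) eps i * phi i a * psi i b *: y i] with signs [eps], where [x], [psi]
    and [y] come from the Dvoretzky--Rogers lemma in [X1], in the dual of [X2] and
    in [Y], and [phi i] is a norming functional of [x i]. *)
Lemma small_perturbation (P : X1 -> X2 -> Y) (N : nat) (tau : R) : 0 < tau ->
  exists (D : X1 -> X2 -> Y) (x : 'I_N -> X1) (z : 'I_N -> X2),
  [/\ bilinear_map D, forall a b, rnorm (D a b) <= tau * rnorm a * rnorm b,
      forall c : 'I_N -> K, rnorm (\sum_i c i *: x i) <=
        2 * Num.sqrt (\sum_i modulus (c i) ^+ 2),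
      forall i, rnorm (z i) <= 1 &
      (N <= 2 * #|[pred j | (tau / 75 <=
         rnorm (P (x j) (z j) + D (x j) (z j)))%R]|)%N].
Proof.
move=> tau0.
have [x [x1 xsum]] := @Dvoretzky_Rogers_space R k X1 N hX1.
have [psi [z [z1 psiz psisum]]] := @Dvoretzky_Rogers_dual R k X2 N hX2.
have [y [y1 ysum]] := @Dvoretzky_Rogers_space R k Y N hY.
have /choice[phi hphi] : forall i, exists f : {scalar X1},
    (forall a, modulus (f a) <= rnorm a) /\ f (x i) = (rnorm (x i))%:K.
  by move=> i; exact: norming_functional.
pose v i a b := ((tau / 4)%:K * phi i a * psi i b) *: y i.
have [eps heps] := exists_good_signs (fun j => P (x j) (z j))
  (fun i j => v i (x j) (z j)).
pose D a b := \sum_i (-1) ^+ (eps i) *: v i a b.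
exists D, x, z; split=> //.
- split=> [b c a a'|a c b b']; rewrite /D scaler_sumr -big_split/=;
    apply: eq_bigr => i _; rewrite /v linearP/= !scalerA -scalerDl;
    congr (_ *: _); ring.
- move=> a b.
  have -> : D a b = \sum_i
      ((-1) ^+ (eps i) * ((tau / 4)%:K * phi i a * psi i b)) *: y i.
    by apply: eq_bigr => i _; rewrite scalerA.
  apply: le_trans (ysum _) _.
  apply: (@le_trans _ _
    (2 * Num.sqrt ((tau / 4 * rnorm a) ^+ 2 * (2 * rnorm b) ^+ 2))).
    rewrite ler_wpM2l// ler_wsqrtr//.
    apply: le_trans (ler_wpM2l (sqr_ge0 _) (psisum b)).
    rewrite mulr_sumr; apply: ler_sum => i _.
    rewrite !modulusM modulus_sign mul1r modulus_real exprMn ler_wpM2r ?sqr_ge0//.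
    rewrite ler_sqr ?nnegrE ?mulr_ge0 ?modulus_ge0 ?rnorm_ge0//; last lra.
    rewrite ger0_norm; last lra.
    by rewrite ler_wpM2l; [|lra|exact: (hphi i).1].
  rewrite -exprMn sqrtr_sqr ger0_norm; first lra.
  by rewrite !mulr_ge0 ?rnorm_ge0//; lra.
- apply: leq_trans heps _; rewrite leq_mul2l/=; apply: subset_leq_card.
  apply/fintype.subsetP => j; rewrite !inE; apply: le_trans.
  rewrite /v rnormZ !modulusM modulus_real (hphi j).2 modulus_real.
  rewrite !ger0_norm ?rnorm_ge0//; last lra.
  have h1 := x1 j; have h2 := psiz j; have h3 := y1 j.
  have h4 : 2 / 5 * (1 / 3) <= rnorm (x j) * modulus (psi j (z j)).
    by rewrite ler_pM//; lra.
  have h5 : 2 / 5 * (1 / 3) * (2 / 5) <=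
      rnorm (x j) * modulus (psi j (z j)) * rnorm (y j).
    by rewrite ler_pM//; lra.
  rewrite -!mulrA.
  have -> : tau / 75 = tau * (4^-1 * (2 / 5 * (1 / 3) * (2 / 5))) by field.
  rewrite ler_pM2l// ler_pM2l ?invr_gt0//; apply: le_trans h5 _.
  by rewrite !mulrA.
Qed.

End Step.

(** * Weights, series and limits *)

(** The scalings of a block of [N] pairs: [alpha] for vectors whose weak [p1]-sum
    is only of order [sqrt N], [lambda] for arbitrary vectors of the unit ball.
    With [q] the exponent in the conclusion, the last bound holds for large [N]
    because its right-hand side is a constant times [N^(q / (2 p1))]. *)
Lemma exists_weights (R : realType) (p1 p2 delta kappa : R) :
  1 <= p1 -> 1 <= p2 -> 0 < delta -> 0 < kappa ->
  exists (N : nat) (alpha lambda : R),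
  [/\ 0 < alpha, 0 < lambda, Num.sqrt N%:R * alpha `^ p1 = delta,
      N%:R * lambda `^ p2 = delta &
      1 <= N%:R * (alpha * lambda * kappa) `^ (p1^-1 + p2^-1)^-1].
Proof.
move=> hp1 hp2 d0 k0; set q := (p1^-1 + p2^-1)^-1.
have p10 : 0 < p1 by rewrite (lt_le_trans ltr01).
have p20 : 0 < p2 by rewrite (lt_le_trans ltr01).
have q0 : 0 < q by rewrite invr_gt0 addr_gt0 ?invr_gt0.
pose th := p1^-1 * q; pose th' := p2^-1 * q.
have th0 : 0 < th.
  by apply: mulr_gt0 => //; rewrite invr_gt0.
have thth : th + th' = 1 by rewrite -mulrDl mulfV// gt_eqF// addr_gt0 ?invr_gt0.
pose M := (delta * kappa `^ q)^-1.
have kq0 : 0 < kappa `^ q by rewrite powR_gt0.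
have M0 : 0 < M by rewrite invr_gt0 mulr_gt0.
pose T := (M `^ th^-1) ^+ 2.
exists (Num.truncn T).+1; set N := (Num.truncn T).+1.
have s0 : 0 < N%:R :> R by rewrite ltr0n.
have sT : T < N%:R := truncnS_gt T.
set s : R := N%:R in s0 sT *.
have r0 : 0 < Num.sqrt s by rewrite sqrtr_gt0.
pose u := delta / Num.sqrt s; pose w := delta / s.
have u0 : 0 < u by rewrite divr_gt0.
have w0 : 0 < w by rewrite divr_gt0.
exists (u `^ p1^-1), (w `^ p2^-1); split.
- by rewrite powR_gt0.
- by rewrite powR_gt0.
- by rewrite -powRrM mulVf ?gt_eqF// powRr1 ?ltW// /u mulrC divfK// gt_eqF.
- by rewrite -powRrM mulVf ?gt_eqF// powRr1 ?ltW// /w mulrC divfK// gt_eqF.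
have uw0 : 0 <= u `^ p1^-1 * w `^ p2^-1 by rewrite mulr_ge0 ?powR_ge0.
rewrite (powRM _ uw0 (ltW k0)) (powRM _ (powR_ge0 _ _) (powR_ge0 _ _)).
rewrite -!powRrM -/th -/th'.
have -> : u = w * Num.sqrt s.
  by rewrite /u /w -{2}(sqr_sqrtr (ltW s0)) expr2; field; rewrite gt_eqF.
rewrite (powRM _ (ltW w0) (ltW r0)) [X in X * _ `^ q]mulrAC -powRD; last first.
  by rewrite thth oner_eq0.
rewrite thth (powRr1 (ltW w0)) /w.
have -> : s * (delta / s * Num.sqrt s `^ th * kappa `^ q) =
    Num.sqrt s `^ th * (delta * kappa `^ q) by field; rewrite gt_eqF.
rewrite -ler_pdivrMr ?mulr_gt0// div1r -/M.
have -> : M = (M `^ th^-1) `^ th.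
  by rewrite -powRrM mulVf ?gt_eqF// (powRr1 (ltW M0)).
apply: (ge0_ler_powR (ltW th0)); rewrite ?nnegrE ?powR_ge0 ?sqrtr_ge0//.
rewrite -(ger0_norm (powR_ge0 M th^-1)) -sqrtr_sqr.
by rewrite ler_wsqrtr// ltW.
Qed.

(** Series whose terms are those of a double sequence with finite rows, enumerated
    by a bijection [e] *)
Section Flatten.
Variables (R : realType) (e : nat -> nat * nat).
Hypothesis e_bij : set_bij [set: nat] [set: nat * nat] e.
Variables (f : nat -> nat -> R) (N : nat -> nat).
Hypothesis f0 : forall m i, 0 <= f m i.
Hypothesis fN : forall m i, (N m <= i)%N -> f m i = 0.

Lemma nneseries_flatten :
  (\sum_(0 <= j <oo) (f (e j).1 (e j).2)%:E =
   \sum_(0 <= m <oo) (\sum_(i < N m) f m i)%:E)%E.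
Proof.
rewrite nneseries_esumT; last by move=> j; rewrite lee_fin.
rewrite -(reindex_esum _ _ _ (fun x : nat * nat => (f x.1 x.2)%:E) e_bij).
rewrite -[X in \esum_(_ in X) _](_ : [set: nat] `*`` (fun=> [set: nat]) = _); last first.
  by apply/seteqP; split.
rewrite -(@esum_esum _ _ _ _ _ (fun m i => (f m i)%:E)); last first.
  by move=> *; rewrite lee_fin.
rewrite [RHS]nneseries_esumT; last by move=> m; rewrite lee_fin sumr_ge0.
apply: eq_esum => m _.
rewrite -nneseries_esumT; last by move=> i; rewrite lee_fin.
rewrite (nneseries_split 0 (N m)); last by move=> i _; rewrite lee_fin.
rewrite add0n [X in (_ + X)%E]eseries0 ?adde0; last by move=> i /fN ->.
by rewrite big_mkord sumEFin.
Qed.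

Lemma nneseries_flatten_lty C :
  0 <= C -> (forall m, \sum_(i < N m) f m i <= C / (2 ^ m.+1)%:R) ->
  (\sum_(0 <= j <oo) (f (e j).1 (e j).2)%:E < +oo)%E.
Proof.
move=> C0 h; rewrite nneseries_flatten.
apply: le_lt_trans (_ : (C%:E < +oo)%E); last by rewrite ltry.
apply: le_trans (epsilon_trick0 xpredT C0).
by apply: lee_nneseries => m *; rewrite lee_fin ?sumr_ge0.
Qed.

Lemma nneseries_flatten_pinfty c :
  0 < c -> (forall m, c <= \sum_(i < N m) f m i) ->
  ~ (\sum_(0 <= j <oo) (f (e j).1 (e j).2)%:E < +oo)%E.
Proof.
move=> c0 h; rewrite nneseries_flatten.
have g0 m : (0 <= (\sum_(i < N m) f m i)%:E)%E by rewrite lee_fin sumr_ge0.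
set S := (\sum_(0 <= m <oo) _)%E => Slt.
have Sge n : ((c *+ n)%:E <= S)%E.
  apply: le_trans (nneseries_lim_ge n _); last by move=> *.
  rewrite -[X in c *+ X](card_ord n) -sumr_const -sumEFin big_mkord.
  by apply: lee_sum => i _; rewrite lee_fin.
have S0 : (0 <= S)%E by rewrite nneseries_ge0.
have Sfin : S \is a fin_num by rewrite ge0_fin_numE.
have := Sge (Num.truncn (fine S / c)).+1.
rewrite -(fineK Sfin) lee_fin leNgt => /negP; apply.
by rewrite -mulr_natr mulrC -ltr_pdivrMr// truncnS_gt.
Qed.

End Flatten.

Section Completeness.
Variables (R : realType) (k : scalar_kind).
Local Notation K := (scalar_field R k).

Lemma rnorm_lt_ball (Y : normedModType K) (x y : Y) (e : K) : 0 < e ->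
  rnorm (x - y) < scalar_Re e -> ball x e y.
Proof.
move=> e0 h; rewrite -ball_normE /= rnormE -(real_scalar_Re (ltW e0)).
by rewrite ltr_real_scalar.
Qed.

Lemma scalar_Re_gt0 (e : K) : 0 < e -> 0 < scalar_Re e.
Proof.
move=> e0; by rewrite -(ltr_real_scalar k) rmorph0 (real_scalar_Re (ltW e0)).
Qed.

Lemma geometric_small (B r e : R) : 0 <= B -> 0 < r < 1 -> 0 < e ->
  exists m, B * r ^+ m < e.
Proof.
move=> B0 /andP[r0 r1] e0.
have e1 : 0 < e / (B + 1) by rewrite divr_gt0// ltr_wpDl.
have /cvgrPdist_lt/(_ _ e1) : r ^+ m @[m --> \oo] --> (0 : R).
  by apply: cvg_expr; rewrite gtr0_norm.
move=> [m _ /(_ m (leqnn m))] /=.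
rewrite sub0r normrN gtr0_norm ?exprn_gt0// => hm; exists m.
rewrite ltr_pdivlMr ?ltr_wpDl// in hm; apply: le_lt_trans hm.
by rewrite mulrC ler_wpM2l ?exprn_ge0 ?ltW// ltrDl.
Qed.

(** Geometrically Cauchy sequences converge at the same rate. *)
Lemma geometric_limit (Y : completeNormedModType K) (u : nat -> Y) (B r : R) :
  0 <= B -> 0 < r < 1 ->
  (forall m n, (m <= n)%N -> rnorm (u n - u m) <= B * r ^+ m) ->
  exists l, forall m, rnorm (l - u m) <= B * r ^+ m.
Proof.
move=> B0 r01 h.
have /cauchy_cvgP : cauchy (u @ \oo).
  apply: cauchy_exP => e e0; have [m hm] := geometric_small B0 r01 (scalar_Re_gt0 e0).
  exists (u m); exists m => // n /= mn; apply: rnorm_lt_ball => //.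
  by rewrite -rnormN opprB (le_lt_trans (h _ _ mn)).
move=> /cvg_ex[l hl]; exists l => m; apply/ler_addgt0Pr => e e0.
have ee0 : 0 < real_scalar R k e.
  by rewrite -(rmorph0 (real_scalar R k)) ltr_real_scalar.
move/cvgrPdist_lt : hl => /(_ _ ee0)[n0 _ hn].
have := hn (maxn n0 m) (leq_maxl _ _); rewrite /= rnormE.
move=> /ltW; rewrite ler_real_scalar => h1.
have -> : l - u m = (u (maxn n0 m) - u m) + (l - u (maxn n0 m)).
  by rewrite [RHS]addrC addrA subrK.
by rewrite (le_trans (rnormD _ _))// lerD// h// leq_maxr.
Qed.

(** A pointwise limit of linear maps, at a geometric rate, is linear. *)
Lemma linear_geometric_limit (X Y : normedModType K) (L : X -> Y)
    (u : nat -> X -> Y) (B : X -> R) (r : R) : 0 < r < 1 ->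
  (forall m, linear (u m)) -> (forall a, 0 <= B a) ->
  (forall m a, rnorm (L a - u m a) <= B a * r ^+ m) -> linear L.
Proof.
move=> r01 linu B0 hL c a a'; apply/eqP; rewrite -subr_eq0.
set v := _ - _; pose C := B (c *: a + a') + (modulus c * B a + B a').
have C0 : 0 <= C by rewrite !addr_ge0// mulr_ge0// modulus_ge0.
have hv m : rnorm v <= C * r ^+ m.
  have -> : v = (L (c *: a + a') - u m (c *: a + a')) -
      (c *: (L a - u m a) + (L a' - u m a')).
    rewrite linu scalerBr [c *: L a - _ + _]addrACA -opprD [in RHS]opprB.
    by rewrite addrA subrK.
  rewrite mulrDl (le_trans (rnormD _ _))// lerD// rnormN mulrDl.
  by rewrite (le_trans (rnormD _ _))// lerD// rnormZ -mulrA ler_wpM2l ?modulus_ge0.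
apply/eqP/rnorm_eq0/eqP; rewrite eq_le rnorm_ge0 andbT leNgt; apply/negP => v0.
have [m hm] := geometric_small C0 r01 v0.
by have := le_lt_trans (hv m) hm; rewrite ltxx.
Qed.

Lemma continuous_functional_bounded (X Y : normedModType K)
    (phi : {linear X -> Y}) : continuous phi ->
  exists2 C : R, 0 < C & forall x, rnorm (phi x) <= C * rnorm x.
Proof.
move=> /linear_bounded_continuous/linear_boundedP/pinfty_ex_gt0[M M0 hM].
exists (scalar_Re M); first exact: scalar_Re_gt0.
move=> x; rewrite -(ler_real_scalar k) rmorphM/= (real_scalar_Re (ltW M0)).
by rewrite -!rnormE hM.
Qed.

Lemma bounded_bilinear_continuous (X1 X2 Y : normedModType K)
    (A : X1 -> X2 -> Y) (B : R) : bilinear_map A ->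
  (forall a b, rnorm (A a b) <= B * rnorm a * rnorm b) ->
  continuous (fun x : (X1 * X2)%type => A x.1 x.2).
Proof.
move=> [linl linr] hB [a0 b0]; apply/cvgrPdist_lt => e e0.
have AlB a a' b : A (a - a') b = A a b - A a' b.
  by rewrite [a - a']addrC -scaleN1r (linl b (-1) a' a) scaleN1r addrC.
have ArB a b b' : A a (b - b') = A a b - A a b'.
  by rewrite [b - b']addrC -scaleN1r (linr a (-1) b' b) scaleN1r addrC.
have re0 := scalar_Re_gt0 e0.
pose C := (`|B| + 1) * (1 + rnorm a0 + rnorm b0).
have Bp : 0 < `|B| + 1 by rewrite ltr_wpDl.
have C1 : 0 < C.
  by rewrite mulr_gt0// -addrA ltr_pwDl// addr_ge0 ?rnorm_ge0.
pose d := Num.min 1 (scalar_Re e / 2 / C).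
have d0 : 0 < d by rewrite lt_min ltr01 !divr_gt0.
have dK0 : 0 < real_scalar R k d.
  by rewrite -(rmorph0 (real_scalar R k)) ltr_real_scalar.
have := nbhsx_ballx ((a0, b0) : (X1 * X2)%type) _ dK0.
apply: filterS => -[a b] [/= ha hb].
have close (Z : normedModType K) (u v : Z) :
    ball u (real_scalar R k d) v -> rnorm (v - u) <= d.
  rewrite -ball_normE /= => /ltW.
  by rewrite rnormE ler_real_scalar -rnormN opprB.
have {}ha := close _ _ _ ha; have {}hb := close _ _ _ hb.
rewrite rnormE -(real_scalar_Re (ltW e0)) ltr_real_scalar -rnormN opprB.
have -> : A a b - A a0 b0 =
    A (a - a0) b0 + (A a0 (b - b0) + A (a - a0) (b - b0)).
  rewrite [A (a - a0) (b - b0)]ArB addrCA [A (a - a0) b0 + _]addrC subrK.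
  by rewrite AlB ArB addrC addrA subrK.
have le2 u v : rnorm (A u v) <= (`|B| + 1) * (rnorm u * rnorm v).
  rewrite (le_trans (hB u v))// -mulrA ler_wpM2r ?mulr_ge0 ?rnorm_ge0//.
  by rewrite (le_trans (ler_norm B))// lerDl.
have hd1 : d <= 1 by rewrite ge_min lexx.
have hde : d * C <= scalar_Re e / 2 by rewrite -ler_pdivlMr// ge_min lexx orbT.
have h1 : rnorm (a - a0) * rnorm b0 <= d * rnorm b0.
  by rewrite ler_wpM2r ?rnorm_ge0.
have h2 : rnorm a0 * rnorm (b - b0) <= d * rnorm a0.
  by rewrite mulrC ler_wpM2r ?rnorm_ge0.
have h3 : rnorm (a - a0) * rnorm (b - b0) <= d * 1.
  by rewrite ler_pM ?rnorm_ge0// (le_trans hb).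
have h4 : rnorm (A (a - a0) b0 + (A a0 (b - b0) + A (a - a0) (b - b0))) <=
    (`|B| + 1) * (d * (1 + rnorm a0 + rnorm b0)).
  rewrite (le_trans (rnormD _ _))// (le_trans (lerD (lexx _) (rnormD _ _)))//.
  apply: le_trans (lerD (le2 _ _) (lerD (le2 _ _) (le2 _ _))) _.
  by rewrite -!mulrDr ler_pM2l//; lra.
rewrite mulrCA -/C in h4; rewrite (le_lt_trans h4)// (le_lt_trans hde)//.
by rewrite ltr_pdivrMr// ltr_pMr// ltr1n.
Qed.

End Completeness.

(** * One block of the construction *)

Section Block.
Variables (R : realType) (k : scalar_kind).
Local Notation K := (scalar_field R k).
Local Notation "t %:K" := (real_scalar R k t) (at level 2, format "t %:K").
Variables X1 X2 Y : normedModType K.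
Hypothesis hX1 : infinite_dimensional X1.
Hypothesis hX2 : infinite_dimensional X2.
Hypothesis hY : infinite_dimensional Y.
Variables p1 p2 : R.
Hypothesis hp1 : 1 <= p1.
Hypothesis hp2 : 1 <= p2.

Let norm_le2 (N : nat) (x : 'I_N -> X1) (i : 'I_N) :
  (forall c : 'I_N -> K, rnorm (\sum_i c i *: x i) <=
     2 * Num.sqrt (\sum_i modulus (c i) ^+ 2)) -> rnorm (x i) <= 2.
Proof.
move=> hx; have := hx (fun j => (j == i)%:R).
rewrite (bigD1 i)//= eqxx scale1r big1 ?addr0; last first.
  by move=> j ji; rewrite (negPf ji) scale0r.
move=> /le_trans; apply; rewrite (bigD1 i)//= eqxx modulus1 expr1n.
rewrite big1 ?addr0 ?sqrtr1 ?mulr1// => j ji.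
by rewrite (negPf ji) modulus0 expr0n.
Qed.

(* The weak p1-sum of N vectors dominated by an orthonormal system is of order
   sqrt N at most: this holds for p1 = 1 by rotating the values of f to their
   moduli, and the terms are bounded. *)
Let weak_sum (N : nat) (x : 'I_N -> X1) (f : {linear X1 -> K^o}) (C : R) :
  (forall c : 'I_N -> K, rnorm (\sum_i c i *: x i) <=
     2 * Num.sqrt (\sum_i modulus (c i) ^+ 2)) ->
  0 < C -> (forall a, rnorm (f a) <= C * rnorm a) ->
  \sum_i rnorm (f (x i)) `^ p1 <= (2 * C) `^ p1 * Num.sqrt N%:R.
Proof.
move=> hx C0 hf.
have C2 : 0 < 2 * C by rewrite mulr_gt0.
have fx i : rnorm (f (x i)) <= 2 * C.
  by rewrite (le_trans (hf _))// mulrC ler_pM2r// norm_le2.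
have sum1 : \sum_i rnorm (f (x i)) <= 2 * C * Num.sqrt N%:R.
  have -> : \sum_i rnorm (f (x i)) = rnorm (f (\sum_i phase (f (x i)) *: x i)).
    rewrite linear_sum/= (_ : \sum_i _ = (\sum_i rnorm (f (x i)))%:K).
      rewrite -[RHS]/(modulus _) modulus_real ger0_norm// sumr_ge0// => i _.
      exact: rnorm_ge0.
    by rewrite rmorph_sum; apply: eq_bigr => i _; rewrite linearZ; exact: phaseM.
  rewrite (le_trans (hf _))// [2 * C]mulrC -mulrA ler_pM2l//.
  rewrite (le_trans (hx _))// ler_pM2l// ler_wsqrtr//.
  rewrite -[X in _ <= X%:R]card_ord -sumr_const ler_sum// => i _.
  by rewrite expr_le1// ?modulus_ge0// modulus_phase.
have pow1 i : rnorm (f (x i)) `^ p1 <= (2 * C) `^ p1 * (rnorm (f (x i)) / (2 * C)).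
  set s := rnorm _; have s0 : 0 <= s := rnorm_ge0 _.
  set w := s / (2 * C).
  have sE : s = 2 * C * w by rewrite /w mulrC divfK// gt_eqF.
  have w0 : 0 <= w by rewrite divr_ge0// ltW.
  rewrite sE (powRM _ (ltW C2) w0) ler_wpM2l ?powR_ge0//.
  move: w0; rewrite le_eqVlt => /predU1P[<-|wp].
    by rewrite powR0// gt_eqF// (lt_le_trans ltr01).
  by apply: ge1r_powR => //; rewrite wp/= ler_pdivrMr// mul1r fx.
apply: le_trans (ler_sum _ (fun i _ => pow1 i)) _.
rewrite -mulr_sumr ler_wpM2l ?powR_ge0// -mulr_suml ler_pdivrMr//.
by rewrite mulrC.
Qed.

(** One block of the construction: a bilinear perturbation [D] of [P], of norm at
    most [tau], and [N] pairs of vectors (continued by zeros) whose weak sums are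
    at most a multiple of [delta], such that every bilinear map close enough to
    [P + D] has on them a sum of [q]-th powers bounded below by [1/2]. *)
Lemma exists_block (P : X1 -> X2 -> Y) (tau delta : R) : 0 < tau -> 0 < delta ->
  exists (D : X1 -> X2 -> Y) (N : nat) (x : nat -> X1) (z : nat -> X2),
  [/\ bilinear_map D /\ forall a b, rnorm (D a b) <= tau * rnorm a * rnorm b,
      forall i, (N <= i)%N -> x i = 0 /\ z i = 0,
      forall (f : {linear X1 -> K^o}) C, 0 < C ->
        (forall a, rnorm (f a) <= C * rnorm a) ->
        \sum_(i < N) rnorm (f (x i)) `^ p1 <= (2 * C) `^ p1 * delta,
      forall (g : {linear X2 -> K^o}) C, 0 < C ->
        (forall b, rnorm (g b) <= C * rnorm b) ->
        \sum_(i < N) rnorm (g (z i)) `^ p2 <= C `^ p2 * delta &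
      forall A : X1 -> X2 -> Y, bilinear_map A ->
        (forall a b, rnorm (P a b + D a b - A a b) <=
           tau / 300 * rnorm a * rnorm b) ->
        1 / 2 <= \sum_(i < N) rnorm (A (x i) (z i)) `^ (p1^-1 + p2^-1)^-1].
Proof.
move=> tau0 delta0; set q := (p1^-1 + p2^-1)^-1.
have kappa0 : 0 < tau / 150 by rewrite divr_gt0.
have [N [alpha [lambda [a0 l0 ha hl hq]]]] := exists_weights hp1 hp2 delta0 kappa0.
have [D [x [z [linD hD hx hz hgood]]]] :=
  small_perturbation hX1 hX2 hY P N tau0.
have p10 : 0 < p1 by rewrite (lt_le_trans ltr01).
have p20 : 0 < p2 by rewrite (lt_le_trans ltr01).
have q0 : 0 <= q by rewrite invr_ge0 addr_ge0// invr_ge0 ltW.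
pose x' i := if insub i is Some j then alpha%:K *: x j else 0.
pose z' i := if insub i is Some j then lambda%:K *: z j else 0.
have x'E (i : 'I_N) : x' i = alpha%:K *: x i by rewrite /x' valK.
have z'E (i : 'I_N) : z' i = lambda%:K *: z i by rewrite /z' valK.
exists D, N, x', z'; split=> //.
- by move=> i Ni; rewrite /x' /z' insubF// ltnNge Ni.
- move=> f C C0 hf; rewrite -ha.
  have -> : \sum_(i < N) rnorm (f (x' i)) `^ p1 =
      alpha `^ p1 * \sum_(i < N) rnorm (f (x i)) `^ p1.
    rewrite mulr_sumr; apply: eq_bigr => i _.
    rewrite x'E linearZ/= rnormZr (gtr0_norm a0).
    by rewrite (powRM _ (ltW a0) (rnorm_ge0 _)).
  by rewrite mulrA [leRHS]mulrC ler_pM2l ?powR_gt0//; exact: weak_sum.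
- move=> g C C0 hg; rewrite -hl.
  rewrite mulrCA mulr_natl -[X in _ *+ X](card_ord N) -sumr_const.
  apply: ler_sum => i _; rewrite -(powRM _ (ltW C0) (ltW l0)).
  apply: ge0_ler_powR;
    rewrite ?nnegrE ?rnorm_ge0 ?mulr_ge0 ?(ltW p20) ?(ltW C0) ?(ltW l0)//.
  rewrite z'E linearZ/= rnormZr (gtr0_norm l0) mulrC ler_pM2r//.
  by rewrite (le_trans (hg _))// ler_piMr// ltW.
- move=> A [linlA linrA] hA.
  have AZ c d a b : A (c *: a) (d *: b) = (c * d) *: A a b.
    rewrite -scalerA -(scalable_linear (linrA a) d b : A a (d *: b) = d *: A a b).
    exact: (scalable_linear (linlA (d *: b)) c a).
  have x2 i : rnorm (x i) <= 2 := norm_le2 i hx.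
  pose good j := tau / 75 <= rnorm (P (x j) (z j) + D (x j) (z j)).
  have goodA j : good j -> (alpha * lambda * (tau / 150)) `^ q <=
      rnorm (A (x' j) (z' j)) `^ q.
    move=> hj; rewrite x'E z'E AZ -rmorphM rnormZr gtr0_norm ?mulr_gt0//.
    have al0 : 0 < alpha * lambda by rewrite mulr_gt0.
    apply: (ge0_ler_powR q0).
    - by rewrite nnegrE mulr_ge0// ltW.
    - by rewrite nnegrE mulr_ge0 ?rnorm_ge0// ltW.
    rewrite (ler_pM2l al0).
    (* A differs from P + D by at most half of tau / 75 *)
    have h1 := hA (x j) (z j).
    have h2 : tau / 300 * rnorm (x j) * rnorm (z j) <= tau / 150.
      rewrite -mulrA (_ : tau / 150 = tau / 300 * 2); last by field.
      rewrite ler_pM2l ?divr_gt0// -[leRHS]mulr1.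
      by rewrite ler_pM ?rnorm_ge0.
    have := rnormD (P (x j) (z j) + D (x j) (z j) - A (x j) (z j)) (A (x j) (z j)).
    by rewrite subrK; move: hj; rewrite /good; lra.
  apply: (@le_trans _ _
    (\sum_(i < N | good i) (alpha * lambda * (tau / 150)) `^ q)).
    rewrite sumr_const -mulr_natl.
    have : (N%:R : R) <= 2 * #|good|%:R by rewrite -natrM ler_nat hgood.
    have := powR_ge0 (alpha * lambda * (tau / 150)) q.
    by move: hq; nra.
  rewrite [leRHS](bigID good)/= -[leLHS]addr0; apply: lerD.
    by apply: ler_sum => i; exact: goodA.
  by rewrite sumr_ge0// => i _; exact: powR_ge0.
Qed.

End Block.

(** * The bilinear map that is not dominated *)

Theorem proposition3p1 (R : realType) (k : scalar_kind)
    (X1 X2 Y : completeNormedModType (scalar_field R k))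
    (hX1 : infinite_dimensional X1) (hX2 : infinite_dimensional X2)
    (hY : infinite_dimensional Y)
    (p1 p2 : R) (hp1 : 1 <= p1) (hp2 : 1 <= p2) :
  exists A : {bilinear X1 -> X2 -> Y},
    continuous (fun x : (X1 * X2)%type => A x.1 x.2) /\
    ~ dominated p1 p2 (fun x1 x2 => A x1 x2).
Proof.
(* With this ratio the perturbations that follow the m-th one have a total norm
   of at most 2 r^(m+1) = r^m / 300, the error allowed by exists_block. *)
pose r : R := 600^-1.
have r0 : 0 < r by rewrite invr_gt0.
pose delta m : R := 1 / (2 ^ m.+1)%:R.
have delta0 m : 0 < delta m by rewrite divr_gt0// ltr0n expn_gt0.
(* F (m, P) is a block for the map P with the parameters of stage m *)
have /choice[F hF] : forall mP : nat * (X1 -> X2 -> Y),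
    exists t : (X1 -> X2 -> Y) * nat * (nat -> X1) * (nat -> X2),
    let D := t.1.1.1 in let N := t.1.1.2 in
    let x := t.1.2 in let z := t.2 in
    [/\ bilinear_map D /\
        forall a b, rnorm (D a b) <= r ^+ mP.1 * rnorm a * rnorm b,
      forall i, (N <= i)%N -> x i = 0 /\ z i = 0,
      forall (f : {linear X1 -> (scalar_field R k)^o}) C, 0 < C ->
        (forall a, rnorm (f a) <= C * rnorm a) ->
        \sum_(i < N) rnorm (f (x i)) `^ p1 <= (2 * C) `^ p1 * delta mP.1,
      forall (g : {linear X2 -> (scalar_field R k)^o}) C, 0 < C ->
        (forall b, rnorm (g b) <= C * rnorm b) ->
        \sum_(i < N) rnorm (g (z i)) `^ p2 <= C `^ p2 * delta mP.1 &
      forall A : X1 -> X2 -> Y, bilinear_map A ->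
        (forall a b, rnorm (mP.2 a b + D a b - A a b) <=
           r ^+ mP.1 / 300 * rnorm a * rnorm b) ->
        1 / 2 <= \sum_(i < N) rnorm (A (x i) (z i)) `^ (p1^-1 + p2^-1)^-1].
  move=> [m P]; have rm : 0 < r ^+ m by rewrite exprn_gt0.
  have [D [N [x [z h]]]] := exists_block hX1 hX2 hY hp1 hp2 P rm (delta0 m).
  by exists (D, N, x, z).
(* P m is the sum of the first m perturbations *)
pose P := fix P m : X1 -> X2 -> Y :=
  if m is n.+1 then fun a b => P n a b + (F (n, P n)).1.1.1 a b
  else fun=> fun=> 0.
have PS m a b : P m.+1 a b = P m a b + (F (m, P m)).1.1.1 a b by [].
pose N m := (F (m, P m)).1.1.2.
pose x m := (F (m, P m)).1.2.
pose z m := (F (m, P m)).2.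
have Plin m : bilinear_map (P m).
  elim: m => [|m [ihl ihr]].
    by split=> [b c a a'|a c b b'] /=; rewrite scaler0 addr0.
  have [[[Dl Dr] _] _ _ _ _] := hF (m, P m).
  split=> [b c a a'|a c b b']; rewrite !PS scalerDr addrACA; congr (_ + _).
  - exact: ihl.
  - exact: Dl.
  - exact: ihr.
  - exact: Dr.
have Pdist m n a b : (m <= n)%N ->
    rnorm (P n a b - P m a b) <= 2 * rnorm a * rnorm b * r ^+ m.
  move=> mn.
  suff : rnorm (P n a b - P m a b) <= 2 * rnorm a * rnorm b * (r ^+ m - r ^+ n).
    move=> /le_trans; apply; rewrite ler_wpM2l ?mulr_ge0 ?rnorm_ge0//.
    by rewrite gerBl exprn_ge0// ltW.
  elim: n mn => [|n ih].
    by rewrite leqn0 => /eqP ->; rewrite !subrr rnorm0 mulr0.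
  rewrite leq_eqVlt => /predU1P[->|mn].
    by rewrite !subrr rnorm0 mulr0.
  have [[_ hD] _ _ _ _] := hF (n, P n).
  rewrite PS addrAC (le_trans (rnormD _ _))//.
  rewrite (le_trans (lerD (ih mn) (hD a b)))//=.
  have := mulr_ge0 (rnorm_ge0 a) (rnorm_ge0 b).
  have rn : 0 < r ^+ n by rewrite exprn_gt0.
  by rewrite exprS /r; nra.
have r1 : 0 < r < 1 by rewrite r0 invf_lt1 ?ltr1n.
have /choice[A0 hA0] : forall ab : X1 * X2, exists l : Y,
    forall m, rnorm (l - P m ab.1 ab.2) <= 2 * rnorm ab.1 * rnorm ab.2 * r ^+ m.
  move=> [a b]; apply: geometric_limit => //.
    by rewrite !mulr_ge0 ?rnorm_ge0.
  by move=> m n mn; exact: Pdist.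
pose A a b := A0 (a, b).
have hA m a b : rnorm (A a b - P m a b) <= 2 * rnorm a * rnorm b * r ^+ m.
  exact: hA0 (a, b) m.
have Alin : bilinear_map A.
  split=> [b|a].
  - apply: (@linear_geometric_limit R k X1 Y (A^~ b) (fun m => (P m)^~ b)
      (fun a => 2 * rnorm a * rnorm b) r) => //.
    + by move=> m; exact: (Plin m).1.
    + by move=> a; rewrite !mulr_ge0 ?rnorm_ge0.
  - apply: (@linear_geometric_limit R k X2 Y (A a) (fun m => P m a)
      (fun b => 2 * rnorm a * rnorm b) r) => //.
    + by move=> m; exact: (Plin m).2.
    + by move=> b; rewrite !mulr_ge0 ?rnorm_ge0.
have Abound a b : rnorm (A a b) <= 2 * rnorm a * rnorm b.
  by have := hA 0%N a b; rewrite /= subr0 expr0 mulr1.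
pose Ab : {bilinear X1 -> X2 -> Y} :=
  HB.pack A (bilinear_isBilinear.Build _ _ _ _ _ _ A Alin).
exists Ab; split; first exact: bounded_bilinear_continuous Alin Abound.
move=> hdom.
(* all blocks are enumerated in one sequence *)
have /card_set_bijP[e he] : ([set: nat] #= [set: nat * nat])%card.
  by rewrite card_eq_sym card_nat2.
pose xs j := x (e j).1 (e j).2; pose zs j := z (e j).1 (e j).2.
have wx : in_weak_lp p1 xs.
  move=> f /continuous_functional_bounded[C C0 hf].
  apply: (@nneseries_flatten_lty R e he (fun m i => rnorm (f (x m i)) `^ p1) N
    _ _ ((2 * C) `^ p1)) => //.
  - by move=> m i; exact: powR_ge0.
  - move=> m i Ni; have [_ /(_ i Ni)[xi0 _] _ _ _] := hF (m, P m).
    by rewrite (xi0 : x m i = 0) linear0 rnorm0 powR0// gt_eqF// (lt_le_trans ltr01).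
  - exact: powR_ge0.
  - move=> m; have [_ _ h _ _] := hF (m, P m).
    by have := h f C C0 hf; rewrite /delta mul1r.
have wz : in_weak_lp p2 zs.
  move=> f /continuous_functional_bounded[C C0 hf].
  apply: (@nneseries_flatten_lty R e he (fun m i => rnorm (f (z m i)) `^ p2) N
    _ _ (C `^ p2)) => //.
  - by move=> m i; exact: powR_ge0.
  - move=> m i Ni; have [_ /(_ i Ni)[_ zi0] _ _ _] := hF (m, P m).
    by rewrite (zi0 : z m i = 0) linear0 rnorm0 powR0// gt_eqF// (lt_le_trans ltr01).
  - exact: powR_ge0.
  - move=> m; have [_ _ _ h _] := hF (m, P m).
    by have := h f C C0 hf; rewrite /delta mul1r.
have := hdom xs zs wx wz.
apply: (@nneseries_flatten_pinfty R e he (fun m i =>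
  rnorm (A (x m i) (z m i)) `^ (p1^-1 + p2^-1)^-1) N _ _ (1 / 2)).
- by move=> m i; exact: powR_ge0.
- move=> m i Ni; have [_ /(_ i Ni)[xi0 zi0] _ _ _] := hF (m, P m).
  rewrite (xi0 : x m i = 0) (zi0 : z m i = 0); have -> : A 0 0 = 0 := linear0r Ab 0.
  have p10 : 0 < p1 by rewrite (lt_le_trans ltr01).
  have p20 : 0 < p2 by rewrite (lt_le_trans ltr01).
  by rewrite rnorm0 powR0// gt_eqF// invr_gt0 addr_gt0 ?invr_gt0.
- by [].
- move=> m; have [_ _ _ _] := hF (m, P m); apply=> // a b.
  rewrite -PS -rnormN opprB (le_trans (hA m.+1 a b))// exprS.
  have := mulr_ge0 (rnorm_ge0 a) (rnorm_ge0 b).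
  have rn : 0 < r ^+ m by rewrite exprn_gt0.
  by rewrite /= /r; nra.
Qed.
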